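(* Let $\mathbf{D}$ be a subcategory of the category of Noetherian rings satisfying the closure conditions listed in the context, and let $\mathcal{P}$ be a ring-theoretic property defined on the objects of $\mathbf{D}$. Assume: (a) for every $A \in \mathbf{D}$, $A$ has $\mathcal{P}$ if and only if $A_{\mathfrak{p}}$ has $\mathcal{P}$ for every prime ideal $\mathfrak{p} \subseteq A$; (b) for every faithfully flat extension of rings $B \to A$ with $A \in \mathbf{D}$, if $A$ has $\mathcal{P}$, then $B$ has $\mathcal{P}$; (c) for every local ring $(A,\mathfrak{m})$ in $\mathbf{D}$ and every nonzero divisor $y \in \mathfrak{m}$, if $A/yA$ has $\mathcal{P}$, then $A$ has $\mathcal{P}$; (d) for every $\mathbb{Z}$-graded Noetherian ring $A=\bigoplus_{n\in\mathbb{Z}}A_n$ in $\mathbf{D}$, $A$ has $\mathcal{P}$ if and only if $A_{\mathfrak{m}}$ has $\mathcal{P}$ for every graded maximal ideal $\mathfrak{m} \subseteq A$. Then for every local ring $(A,\mathfrak{m})$ in $\mathbf{D}$ and every ideal $I \subseteq \mathfrak{m}$, if the associated graded ring $G(I)=\bigoplus_{n\ge 0} I^n/I^{n+1}$ has $\mathcal{P}$, then $A$ has $\mathcal{P}$.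
   Context: All rings are commutative with unit. The subcategory $\mathbf{D}$ of the category of Noetherian rings is assumed to satisfy the following: if $A \in \mathbf{D}$, then (i) every finitely generated $A$-algebra belongs to $\mathbf{D}$; (ii) every localization of $A$ with respect to a multiplicative subset of $A$ belongs to $\mathbf{D}$; (iii) every subring $B \subseteq A$ such that $A$ is faithfully flat over $B$ belongs to $\mathbf{D}$; (iv) for every ideal $I \subseteq A$, the Rees ring $A[It]=\bigoplus_{n\ge 0} I^n t^n \subseteq A[t]$ and the extended Rees ring $A[It,t^{-1}]=\bigoplus_{n\in\mathbb{Z}} I^n t^n \subseteq A[t,t^{-1}]$ (with $I^n=A$ for $n\le 0$) belong to $\mathbf{D}$. A ring-theoretic property is a property of rings in $\mathbf{D}$ invariant under ring isomorphism. A graded maximal ideal of a $\mathbb{Z}$-graded ring is an ideal that is maximal among the proper homogeneous ideals (such an ideal is prime, but need not be a maximal ideal of the ring). *)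

(* Defs.v *)
From HB Require Import structures.
From mathcomp Require Import all_boot all_order all_algebra finmap.
From mathcomp Require Import mathcomp_extra boolp classical_sets.
From mathcomp.multinomials Require Import monalg.
From mathcomp Require Import ring zify.

Set Implicit Arguments.
Unset Strict Implicit.
Unset Printing Implicit Defensive.

Import Order.TTheory GRing.Theory Num.Theory.
Import Quotient.Exports.

Local Open Scope quotient_scope.
Local Open Scope classical_set_scope.
Local Open Scope ring_scope.

(* Rings are [comPzRingType]s, so that the zero ring is allowed.  The ideals, *)
(* quotients and (Laurent) polynomials of the library require 1 != 0, or that *)
(* the ideal is proper, hence the versions below.                             *)

Record ideal (A : comPzRingType) := Ideal {
  ideal_set :> A -> Prop;
  ideal0 : ideal_set 0;
  idealD : forall x y, ideal_set x -> ideal_set y -> ideal_set (x + y);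
  idealMl : forall a x, ideal_set x -> ideal_set (a * x) }.

Section Ideals.
Variable A : comPzRingType.
Implicit Types I J : ideal A.

Lemma idealMr I x a : I x -> I (x * a).
Proof. by rewrite mulrC; exact: idealMl. Qed.

Lemma idealN I x : I x -> I (- x).
Proof. by rewrite -mulN1r; exact: idealMl. Qed.

Lemma idealB I x y : I x -> I y -> I (x - y).
Proof. by move=> Ix Iy; apply: idealD => //; exact: idealN. Qed.

Lemma ideal_sum I (T : eqType) (s : seq T) (P : pred T) (F : T -> A) :
  (forall i, i \in s -> P i -> I (F i)) -> I (\sum_(i <- s | P i) F i).
Proof.
move=> sI; rewrite big_seq_cond.
by apply: big_ind => [||i /andP[]]; [exact: ideal0|exact: idealD|exact: sI].
Qed.

Definition proper I := ~ I 1.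

Definition prime_ideal I := proper I /\ forall x y, I (x * y) -> I x \/ I y.

Definition maximal_ideal I :=
  proper I /\ forall J, proper J -> I `<=` J -> J `<=` I.

Definition local_ring (m : ideal A) :=
  maximal_ideal m /\ forall n : ideal A, maximal_ideal n -> n = m :> set A.

Definition noetherian := forall I, exists s : seq A, forall x,
  I x <-> exists c : nat -> A, x = \sum_(i < size s) c i * s`_i.

Definition nonzerodivisor (y : A) := forall x, y * x = 0 -> x = 0.

Definition unit_ideal : ideal A := @Ideal A setT
  Logic.I (fun _ _ _ _ => Logic.I) (fun _ _ _ => Logic.I).

Definition zero_ideal : ideal A.
Proof.
exists [set 0] => [//|_ _ -> ->|a _ ->] /=; first by rewrite addr0.
by rewrite mulr0.
Defined.

Definition principal (y : A) : ideal A.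
Proof.
exists [set x | exists a, x = y * a] => [|_ _ [a ->] [b ->]|b _ [a ->]] /=.
- by exists 0; rewrite mulr0.
- by exists (a + b); rewrite mulrDr.
- by exists (b * a); rewrite mulrCA.
Defined.

Definition ideal_mul I J : ideal A.
Proof.
exists [set x | exists2 s : seq (A * A),
          forall p, p \in s -> I p.1 /\ J p.2 & x = \sum_(p <- s) p.1 * p.2].
- by exists [::]; rewrite ?big_nil.
- move=> _ _ [s sIJ ->] [t tIJ ->]; exists (s ++ t); last by rewrite big_cat.
  by move=> p; rewrite mem_cat => /orP[/sIJ|/tIJ].
- move=> a _ [s sIJ ->]; exists [seq (a * p.1, p.2) | p <- s].
    by move=> _ /mapP[p /sIJ[Ip Jp] ->]; split=> //; exact: idealMl.
  by rewrite big_map mulr_sumr; apply: eq_bigr => p _; rewrite mulrA.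
Defined.

Definition ideal_exp I n : ideal A := iter n (ideal_mul I) unit_ideal.

Lemma ideal_mul_in I J x y : I x -> J y -> ideal_mul I J (x * y).
Proof.
by move=> Ix Jy; exists [:: (x, y)]; [move=> p; rewrite inE => /eqP->|rewrite big_seq1].
Qed.

Lemma ideal_expS I n : ideal_exp I n.+1 `<=` ideal_exp I n.
Proof.
elim: n => [//|n IHn] x [s sI ->]; apply: ideal_sum => p /sI[Ip Jp] _.
by apply: ideal_mul_in => //; exact: IHn.
Qed.

Lemma ideal_expD I m n x y :
  ideal_exp I m x -> ideal_exp I n y -> ideal_exp I (m + n) (x * y).
Proof.
elim: m x => [|m IHm] x; first by move=> _; exact: idealMl.
move=> [s sI ->] Iy; rewrite mulr_suml; apply: ideal_sum => p /sI[Ip Jp] _.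
by rewrite -mulrA; apply: ideal_mul_in => //; exact: IHm.
Qed.

Definition ideal_pred I : {pred A} := fun x => `[< I x >].

Lemma ideal_predE I x : (x \in ideal_pred I) = `[< I x >]. Proof. by []. Qed.

Lemma ideal_pred_zmod_closed I : zmod_closed (ideal_pred I).
Proof.
split=> [|x y /asboolP Ix /asboolP Iy]; apply/asboolP; first exact: ideal0.
exact: idealB.
Qed.
HB.instance Definition _ I :=
  GRing.isZmodClosed.Build A (ideal_pred I) (ideal_pred_zmod_closed I).

End Ideals.

Definition quotient_ring (A : comPzRingType) (I : ideal A) :=
  Quotient.quot (ideal_pred I).

Section QuotientRing.
Variables (A : comPzRingType) (I : ideal A).
Notation Q := (quotient_ring I).
HB.instance Definition _ := GRing.Zmodule.on Q.

Definition qclass (x : A) : Q := \pi x.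

Lemma qclass_eq x y : qclass x = qclass y <-> I (x - y).
Proof.
rewrite /qclass; split=> [/eqP|Ixy]; first by rewrite -Quotient.idealrBE => /asboolP.
by apply/eqP; rewrite -Quotient.idealrBE; apply/asboolP.
Qed.

Lemma qclassK (x : Q) : qclass (repr x) = x. Proof. exact: reprK. Qed.

Lemma qclassD x y : qclass (x + y) = qclass x + qclass y.
Proof. by rewrite /qclass !piE. Qed.

Definition qone : Q := qclass 1.
Definition qmul (x y : Q) : Q := qclass (repr x * repr y).

Lemma qmulE x y : qmul (qclass x) (qclass y) = qclass (x * y).
Proof.
apply/qclass_eq; set x' := repr _; set y' := repr _.
have Ix : I (x' - x) by apply/qclass_eq; exact: qclassK.
have Iy : I (y' - y) by apply/qclass_eq; exact: qclassK.
have -> : x' * y' - x * y = (x' - x) * y' + x * (y' - y) by ring.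
by apply: idealD; [exact: idealMr|exact: idealMl].
Qed.

Lemma qmulA : associative qmul.
Proof.
move=> x y z; rewrite -[x]qclassK -[y]qclassK -[z]qclassK.
by rewrite !qmulE mulrA.
Qed.

Lemma qmulC : commutative qmul.
Proof. by move=> x y; rewrite -[x]qclassK -[y]qclassK !qmulE mulrC. Qed.

Lemma qmul1 : left_id qone qmul.
Proof. by move=> x; rewrite -[x]qclassK qmulE mul1r. Qed.

Lemma qmulDl : left_distributive qmul +%R.
Proof.
move=> x y z; rewrite -[x]qclassK -[y]qclassK -[z]qclassK.
by rewrite -qclassD !qmulE -qclassD mulrDl.
Qed.

HB.instance Definition _ :=
  GRing.Zmodule_isComPzRing.Build Q qmulA qmulC qmul1 qmulDl.

End QuotientRing.

Definition multiplicative_set (A : comPzRingType) (S : set A) :=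
  S 1 /\ forall x y, S x -> S y -> S (x * y).

Section Localization.
Variables (A : comPzRingType) (S : set A).

Definition mul_closure : set A :=
  [set x | exists2 s : seq A, forall y, y \in s -> S y & x = \prod_(y <- s) y].

Lemma mul_closure1 : mul_closure 1.
Proof. by exists [::]; rewrite ?big_nil. Qed.

Lemma mul_closureM x y : mul_closure x -> mul_closure y -> mul_closure (x * y).
Proof.
move=> [s sS ->] [t tS ->]; exists (s ++ t); last by rewrite big_cat.
by move=> p; rewrite mem_cat => /orP[/sS|/tS].
Qed.

Lemma mul_closure_id : multiplicative_set S -> mul_closure = S.
Proof.
move=> [S1 SM]; apply/seteqP; split=> [_ [s sS ->]|x Sx].
  by rewrite big_seq; apply: big_ind.
by exists [:: x]; [move=> y; rewrite inE => /eqP->|rewrite big_seq1].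
Qed.

Definition denominator := {s : A | `[< mul_closure s >]}.

Definition dval (s : denominator) : A := sval s.

Lemma denominatorP (s : denominator) : mul_closure (dval s).
Proof. exact/asboolP/(valP s). Qed.

Definition den_mk s (Ss : mul_closure s) : denominator :=
  exist _ s (asboolT Ss).

Definition den1 := den_mk mul_closure1.
Definition denM (s t : denominator) :=
  den_mk (mul_closureM (denominatorP s) (denominatorP t)).

Lemma dval1 : dval den1 = 1. Proof. by []. Qed.
Lemma dvalM s t : dval (denM s t) = dval s * dval t. Proof. by []. Qed.
Let dvalE := (dval1, dvalM).

Definition frac_equiv (x y : A * denominator) : bool :=
  `[< exists2 u, mul_closure u &
      u * (x.1 * dval y.2) = u * (y.1 * dval x.2) >].

Lemma frac_equivP : equiv_class_of frac_equiv.
Proof.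
split=> [x|x y|y x z].
- by apply/asboolP; exists 1 => //; exact: mul_closure1.
- by apply: asbool_equiv_eq; split=> -[u Su e]; exists u.
- move=> /asboolP[u Su e] /asboolP[v Sv f]; apply/asboolP.
  exists (u * v * dval y.2).
    by do 2?apply: mul_closureM => //; exact: denominatorP.
  have -> : u * v * dval y.2 * (x.1 * dval z.2) =
            v * dval z.2 * (u * (x.1 * dval y.2)) by ring.
  rewrite e.
  have -> : u * v * dval y.2 * (z.1 * dval x.2) =
            u * dval x.2 * (v * (z.1 * dval y.2)) by ring.
  by rewrite -f; ring.
Qed.

Canonical frac_equiv_rel := EquivRelPack frac_equivP.
Canonical frac_encModRel := defaultEncModRel frac_equiv.

(* The ring of fractions [a / s], with [s] in the multiplicative subset       *)
(* generated by [S]; this subset is [S] itself if [S] is multiplicative, by   *)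
(* [mul_closure_id].  Thus [localization (~` p)] is [A_p] for [p] prime.       *)
Definition localization := {eq_quot frac_equiv}.
HB.instance Definition _ := Choice.on localization.

Definition frac (a : A) (s : denominator) : localization :=
  \pi_localization (a, s).

Lemma frac_eq a s b t : frac a s = frac b t <->
  exists2 u, mul_closure u & u * (a * dval t) = u * (b * dval s).
Proof.
rewrite /frac; split=> [/eqP|h]; first by rewrite piE => /asboolP.
by apply/eqP; rewrite piE; apply/asboolP.
Qed.

Definition num (x : localization) : A := (repr x).1.
Definition den (x : localization) : denominator := (repr x).2.

Lemma fracK x : frac (num x) (den x) = x.
Proof. by rewrite /frac /num /den -surjective_pairing reprK. Qed.

Definition loc0 := frac 0 den1.
Definition loc1 := frac 1 den1.
Definition locN x := frac (- num x) (den x).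
Definition locD x y :=
  frac (num x * dval (den y) + num y * dval (den x)) (denM (den x) (den y)).
Definition locM x y := frac (num x * num y) (denM (den x) (den y)).

Lemma locNE a s : locN (frac a s) = frac (- a) s.
Proof.
have /frac_eq[u Su e] := fracK (frac a s).
apply/frac_eq; exists u => //.
by rewrite !mulNr !mulrN e.
Qed.

Lemma locDE a s b t : locD (frac a s) (frac b t) =
  frac (a * dval t + b * dval s) (denM s t).
Proof.
have /frac_eq[u Su e] := fracK (frac a s).
have /frac_eq[v Sv f] := fracK (frac b t).
rewrite /locD; move: (num (frac a s)) (den (frac a s)) (num (frac b t)) (den (frac b t)) e f
  => a' s' b' t' e f.
apply/frac_eq; exists (u * v); first exact: mul_closureM.
rewrite !dvalE.
have -> : u * v * ((a' * dval t' + b' * dval s') * (dval s * dval t)) =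
  v * dval t' * dval t * (u * (a' * dval s)) +
  u * dval s' * dval s * (v * (b' * dval t)) by ring.
by rewrite e f; ring.
Qed.

Lemma locME a s b t : locM (frac a s) (frac b t) = frac (a * b) (denM s t).
Proof.
have /frac_eq[u Su e] := fracK (frac a s).
have /frac_eq[v Sv f] := fracK (frac b t).
rewrite /locM; move: (num (frac a s)) (den (frac a s)) (num (frac b t)) (den (frac b t)) e f
  => a' s' b' t' e f.
apply/frac_eq; exists (u * v); first exact: mul_closureM.
rewrite !dvalE.
have -> : u * v * (a' * b' * (dval s * dval t)) =
  (u * (a' * dval s)) * (v * (b' * dval t)) by ring.
by rewrite e f; ring.
Qed.

Let locE := (locNE, locDE, locME).

Lemma frac_eqw a s b t : a * dval t = b * dval s -> frac a s = frac b t.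
Proof.
by move=> e; apply/frac_eq; exists 1; [exact: mul_closure1|rewrite e].
Qed.

Lemma locDA : associative locD.
Proof.
move=> x y z; rewrite -[x]fracK -[y]fracK -[z]fracK !locE.
by apply: frac_eqw; rewrite !dvalE; ring.
Qed.

Lemma locDC : commutative locD.
Proof.
by move=> x y; rewrite -[x]fracK -[y]fracK !locE; apply: frac_eqw; rewrite !dvalE; ring.
Qed.

Lemma locD0 : left_id loc0 locD.
Proof.
by move=> x; rewrite -[x]fracK !locE; apply: frac_eqw; rewrite !dvalE; ring.
Qed.

Lemma locDN : left_inverse loc0 locN locD.
Proof.
by move=> x; rewrite -[x]fracK !locE; apply: frac_eqw; rewrite !dvalE; ring.
Qed.

Lemma locMA : associative locM.
Proof.
move=> x y z; rewrite -[x]fracK -[y]fracK -[z]fracK !locE.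
by apply: frac_eqw; rewrite !dvalE; ring.
Qed.

Lemma locMC : commutative locM.
Proof.
by move=> x y; rewrite -[x]fracK -[y]fracK !locE; apply: frac_eqw; rewrite !dvalE; ring.
Qed.

Lemma locM1 : left_id loc1 locM.
Proof.
by move=> x; rewrite -[x]fracK !locE; apply: frac_eqw; rewrite !dvalE; ring.
Qed.

Lemma locMDl : left_distributive locM locD.
Proof.
move=> x y z; rewrite -[x]fracK -[y]fracK -[z]fracK !locE.
by apply: frac_eqw; rewrite !dvalE; ring.
Qed.

HB.instance Definition _ :=
  GRing.isZmodule.Build localization locDA locDC locD0 locDN.
HB.instance Definition _ :=
  GRing.Zmodule_isComPzRing.Build localization locMA locMC locM1 locMDl.

End Localization.

Arguments localization {A} S.

(* [A[t, t^-1]]: finitely supported maps [int -> A], with the convolution     *)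
(* product; [g@_n] is the coefficient of [t^n] in [g] and [<< a *g n >>] is   *)
(* the monomial [a t^n].                                                      *)
Definition laurent (A : comPzRingType) := {malg A[int]}.

Section Laurent.
Variable A : comPzRingType.
Notation L := (laurent A).
HB.instance Definition _ := GRing.Zmodule.on L.
Implicit Types g : L.

Definition lone : L := << 1 *g 0%:Z >>.

Definition lmul g1 g2 : L :=
  \sum_(k1 <- msupp g1) \sum_(k2 <- msupp g2) << g1@_k1 * g2@_k2 *g k1 + k2 >>.

Lemma lmulw (d1 d2 : {fset int}) g1 g2 :
  (msupp g1 `<=` d1)%fset -> (msupp g2 `<=` d2)%fset ->
  lmul g1 g2 = \sum_(k1 <- d1) \sum_(k2 <- d2) << g1@_k1 * g2@_k2 *g k1 + k2 >>.
Proof.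
move=> le_d1 le_d2; rewrite /lmul (big_fset_incl _ le_d1) /=.
  apply/eq_bigr=> k1 _; apply/big_fset_incl => // k _ /mcoeff_outdom ->.
  by rewrite mulr0 monalgU0.
move=> k _ /mcoeff_outdom g1k.
by rewrite big1 => // k' _; rewrite g1k mul0r monalgU0.
Qed.

Lemma lmulC : commutative lmul.
Proof.
move=> g1 g2; rewrite /lmul exchange_big; apply/eq_bigr => k1 _.
by apply/eq_bigr => k2 _; rewrite mulrC addrC.
Qed.

Lemma lmulDl : left_distributive lmul +%R.
Proof.
move=> g1 g2 g; rewrite (lmulw (fsubsetUl (msupp g1) (msupp g2)) (fsubset_refl _)).
rewrite (lmulw (fsubsetUr (msupp g1) (msupp g2)) (fsubset_refl _)).
rewrite (lmulw (msuppD_le g1 g2) (fsubset_refl _)).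
rewrite -big_split /=; apply/eq_bigr=> k1 _.
rewrite -big_split /=; apply/eq_bigr=> k2 _.
by rewrite mcoeffD mulrDl monalgUD.
Qed.

Lemma lmulDr : right_distributive lmul +%R.
Proof. by move=> g g1 g2; rewrite !(lmulC g) lmulDl. Qed.

Lemma lmul0 : left_zero 0 lmul.
Proof. by move=> g; rewrite /lmul msupp0 big_seq_fset0. Qed.

Lemma lmul0r : right_zero 0 lmul.
Proof. by move=> g; rewrite lmulC lmul0. Qed.

Lemma laurent_ind (P : L -> Prop) : P 0 ->
  (forall g1 g2, P g1 -> P g2 -> P (g1 + g2)) ->
  (forall c (k : int), P << c *g k >>) -> forall g, P g.
Proof. by move=> P0 PD PU g; rewrite [g]monalgE; apply: big_ind. Qed.

Lemma lmulUU c1 c2 (k1 k2 : int) :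
  lmul << c1 *g k1 >> << c2 *g k2 >> = << c1 * c2 *g k1 + k2 >>.
Proof. by rewrite (lmulw msuppU_le msuppU_le) !big_seq_fset1 !mcoeffUU. Qed.

Lemma lmul1 : left_id lone lmul.
Proof.
elim/laurent_ind => [|g1 g2 e1 e2|c k]; first exact: lmul0r.
- by rewrite lmulDr e1 e2.
- by rewrite lmulUU mul1r add0r.
Qed.

Lemma lmulA : associative lmul.
Proof.
elim/laurent_ind => [g2 g3|f g e1 e2 g2 g3|c1 k1]; first by rewrite !lmul0.
  by rewrite !lmulDl e1 e2.
elim/laurent_ind => [g3|f g e1 e2 g3|c2 k2]; first by rewrite lmul0r !lmul0 lmul0r.
  by rewrite lmulDl !lmulDr lmulDl e1 e2.
elim/laurent_ind => [|f g e1 e2|c3 k3]; first by rewrite !lmul0r.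
  by rewrite !lmulDr e1 e2.
by rewrite !lmulUU mulrA addrA.
Qed.

HB.instance Definition _ :=
  GRing.Zmodule_isComPzRing.Build L lmulA lmulC lmul1 lmulDl.

Lemma laurent1_coef n : (1 : L)@_n = 1 *+ (0 == n).
Proof. exact: mcoeffU. Qed.

Lemma laurentM_coef (d : {fset int}) g1 g2 n : (msupp g1 `<=` d)%fset ->
  (g1 * g2)@_n = \sum_(k <- d) g1@_k * g2@_(n - k).
Proof.
move=> le_d; rewrite [g1 * g2](lmulw le_d (fsubset_refl _)) raddf_sum /=.
apply: eq_bigr => k _; rewrite raddf_sum /=.
have [g2k|g2k] := boolP (n - k \in msupp g2).
  rewrite (big_fsetD1 _ g2k) /= mcoeffU subrKC eqxx mulr1n.
  rewrite big1_fset ?addr0 // => k'; rewrite !inE => /andP[/eqP k'n _] _.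
  by rewrite mcoeffU; case: eqP => // e; case: k'n; rewrite -e addrAC subrr add0r.
rewrite (mcoeff_outdom g2k) mulr0 big1_fset // => k' k'g _.
rewrite mcoeffU; case: eqP => // e; move: g2k.
by rewrite -e addrAC subrr add0r k'g.
Qed.

End Laurent.

Record filtration (A : comPzRingType) := Filtration {
  fil :> int -> ideal A;
  fil1 : fil 0 1;
  filM : forall m n x y, fil m x -> fil n y -> fil (m + n) (x * y) }.

Section FiltrationRing.
Variables (A : comPzRingType) (F : filtration A).

Definition fil_pred : {pred laurent A} :=
  fun g => `[< forall n, F n g@_n >].

Lemma fil_predP g : reflect (forall n, F n g@_n) (g \in fil_pred).
Proof. exact: asboolP. Qed.

Lemma fil_pred_subring : subring_closed fil_pred.
Proof.
split=> [|f g /fil_predP Ff /fil_predP Fg|f g /fil_predP Ff /fil_predP Fg];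
  apply/fil_predP => n.
- by rewrite laurent1_coef; case: eqP => [<-|_]; [exact: fil1|exact: ideal0].
- by rewrite mcoeffB; exact: idealB.
- rewrite (laurentM_coef _ _ (fsubset_refl _)); apply: ideal_sum => k _ _.
  by have := filM (Ff k) (Fg (n - k)); rewrite subrKC.
Qed.
HB.instance Definition _ :=
  GRing.isSubringClosed.Build (laurent A) fil_pred fil_pred_subring.

(* $\bigoplus_n F_n t^n \subseteq A[t, t^{-1}]$ *)
Definition fil_ring := {g : laurent A | g \in fil_pred}.
HB.instance Definition _ := SubType.on fil_ring.
HB.instance Definition _ := Choice.on fil_ring.
HB.instance Definition _ := 
  GRing.SubChoice_isSubComPzRing.Build (laurent A) fil_pred fil_ring
    fil_pred_subring.

End FiltrationRing.

Section ReesRings.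
Variables (A : comPzRingType) (I : ideal A).

Definition rees_ideal (n : int) : ideal A :=
  if n is Posz k then ideal_exp I k else zero_ideal A.

Definition ext_rees_ideal (n : int) : ideal A :=
  if n is Posz k then ideal_exp I k else unit_ideal A.

Lemma rees_idealM m n x y :
  rees_ideal m x -> rees_ideal n y -> rees_ideal (m + n) (x * y).
Proof.
case: m n => m [] n; first exact: ideal_expD.
- by move=> _ ->; rewrite mulr0; exact: ideal0.
- by move=> -> _; rewrite mul0r; exact: ideal0.
- by move=> -> _; rewrite mul0r; exact: ideal0.
Qed.

Lemma ideal_exp_le m n : (m <= n)%N -> ideal_exp I n `<=` ideal_exp I m.
Proof.
elim: n => [|n IHn]; first by rewrite leqn0 => /eqP->.
rewrite leq_eqVlt => /predU1P[->//|/IHn le_nm].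
exact: subset_trans (@ideal_expS _ I n) le_nm.
Qed.

Lemma ext_rees_ideal_le (m n : int) : m <= n ->
  ext_rees_ideal n `<=` ext_rees_ideal m.
Proof. by case: m n => m [] n //; exact: ideal_exp_le. Qed.

Lemma ext_rees_idealM m n x y :
  ext_rees_ideal m x -> ext_rees_ideal n y -> ext_rees_ideal (m + n) (x * y).
Proof.
case: m n => m [] n Ix Iy; first exact: ideal_expD.
- apply: (@ext_rees_ideal_le _ m); last exact: idealMr.
  by rewrite gerDl.
- apply: (@ext_rees_ideal_le _ n); last exact: idealMl.
  by rewrite gerDr.
- by [].
Qed.

Definition rees_fil := @Filtration A rees_ideal Logic.I rees_idealM.
Definition ext_rees_fil :=
  @Filtration A ext_rees_ideal Logic.I ext_rees_idealM.

(* $A[It]$, seen in $A[t, t^{-1}]$, and $A[It, t^{-1}]$ *)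
Definition rees_ring := fil_ring rees_fil.
Definition ext_rees_ring := fil_ring ext_rees_fil.
HB.instance Definition _ := GRing.ComPzRing.on rees_ring.
HB.instance Definition _ := GRing.ComPzRing.on ext_rees_ring.

End ReesRings.

Section Subquotient.
Variables (A : comPzRingType) (I J : ideal A).

Definition ideal_sub := {x : A | x \in ideal_pred I}.
HB.instance Definition _ := SubType.on ideal_sub.
HB.instance Definition _ := Choice.on ideal_sub.
HB.instance Definition _ := [SubChoice_isSubZmodule of ideal_sub by <:].

Definition subq_pred : {pred ideal_sub} := fun x => val x \in ideal_pred J.

Lemma subq_pred_zmod_closed : zmod_closed subq_pred.
Proof.
split=> [|x y Jx Jy]; rewrite -topredE /= /subq_pred; first by rewrite raddf0 rpred0.
by rewrite raddfB rpredB.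
Qed.
HB.instance Definition _ :=
  GRing.isZmodClosed.Build ideal_sub subq_pred subq_pred_zmod_closed.

(* $I / (I \cap J)$, that is $I / J$ for $J \subseteq I$ *)
Definition subquotient := Quotient.quot subq_pred.
HB.instance Definition _ := GRing.Zmodule.on subquotient.

(* The class of [a]; only meaningful for [a] in [I]. *)
Definition subq_class (a : A) : subquotient :=
  \pi_subquotient (insubd (0 : ideal_sub) a).

Definition subq_repr (x : subquotient) : A := val (repr x).

Lemma subq_reprP x : I (subq_repr x).
Proof. exact/asboolP/(valP (repr x)). Qed.

Lemma subq_reprK x : subq_class (subq_repr x) = x.
Proof. by rewrite /subq_class valKd reprK. Qed.

Lemma subq_class_eq a b : I a -> I b ->
  subq_class a = subq_class b <-> J (a - b).
Proof.
move=> Ia Ib.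
have e : val (insubd (0 : ideal_sub) a - insubd (0 : ideal_sub) b) = a - b.
  by rewrite raddfB /= !val_insubd !ideal_predE !asboolT.
split=> [/eqP|Jab]; first by rewrite -Quotient.idealrBE => /asboolP; rewrite e.
by apply/eqP; rewrite -Quotient.idealrBE; apply/asboolP; rewrite e.
Qed.

Lemma subq_classD a b : I a -> I b ->
  subq_class (a + b) = subq_class a + subq_class b.
Proof.
move=> Ia Ib; rewrite /subq_class.
have -> : insubd (0 : ideal_sub) (a + b) = insubd 0 a + insubd 0 b.
  apply: val_inj; rewrite raddfD /= !val_insubd !ideal_predE !asboolT //.
  exact: idealD.
by rewrite !piE.
Qed.

Lemma subq_class0 : subq_class 0 = 0.
Proof. by apply: (addIr (subq_class 0)); rewrite add0r -subq_classD ?addr0 //; exact: ideal0. Qed.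

Lemma subq_repr_eq0 (x : subquotient) : x = 0 -> J (subq_repr x).
Proof.
move=> x0; rewrite -[subq_repr x]subr0.
apply/subq_class_eq; [exact: subq_reprP|exact: ideal0|].
by rewrite subq_reprK subq_class0.
Qed.

End Subquotient.

Section AssociatedGraded.
Variables (A : comPzRingType) (I : ideal A).

Definition gr_piece n := subquotient (ideal_exp I n) (ideal_exp I n.+1).

Record gr := Gr {
  gr_coef :> forall n, gr_piece n;
  gr_finite : exists N, forall n, (N <= n)%N -> gr_coef n = 0 }.

HB.instance Definition _ := gen_eqMixin gr.
HB.instance Definition _ := gen_choiceMixin gr.

Implicit Types x y z : gr.

Lemma grP x y : (forall n, x n = y n) -> x = y.
Proof.
case: x y => [x xP] [y yP] /= e; have {}e : x = y.
  exact: functional_extensionality_dep.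
by case: _ / e yP => yP; congr Gr; exact: Prop_irrelevance.
Qed.

Definition gr0 : gr.
Proof. by exists (fun _ => 0); exists 0%N. Defined.

Definition gr_opp x : gr.
Proof.
exists (fun n => - x n).
by have [N xN] := gr_finite x; exists N => n /xN->; rewrite oppr0.
Defined.

Definition gr_add x y : gr.
Proof.
exists (fun n => x n + y n).
have [N xN] := gr_finite x; have [M yM] := gr_finite y.
by exists (maxn N M) => n; rewrite geq_max => /andP[/xN-> /yM->]; rewrite addr0.
Defined.

Lemma gr_addA : associative gr_add.
Proof. by move=> x y z; apply: grP => n /=; rewrite addrA. Qed.

Lemma gr_addC : commutative gr_add.
Proof. by move=> x y; apply: grP => n /=; rewrite addrC. Qed.

Lemma gr_add0 : left_id gr0 gr_add.
Proof. by move=> x; apply: grP => n /=; rewrite add0r. Qed.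

Lemma gr_addN : left_inverse gr0 gr_opp gr_add.
Proof. by move=> x; apply: grP => n /=; rewrite addNr. Qed.

HB.instance Definition _ := GRing.isZmodule.Build gr gr_addA gr_addC gr_add0 gr_addN.

(* Only meaningful for [a] in [I ^ n]. *)
Definition gr_class n (a : A) : gr_piece n := subq_class _ _ a.

Definition gr_one : gr.
Proof.
exists (fun n => if n is 0%N then gr_class 0 1 else 0).
by exists 1%N => -[].
Defined.

(* The product of the classes of $a \in I^i$ and $b \in I^j$ is the class of  *)
(* $ab$ in degree $i + j$.                                                     *)
Definition gr_mul x y : gr.
Proof.
exists (fun n => \sum_(i < n.+1)
  gr_class n (subq_repr (x i) * subq_repr (y (n - i)%N))).
have [N xN] := gr_finite x; have [M yM] := gr_finite y.
exists (N + M)%N => n le_n; apply: big1 => i _.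
have Ii := subq_reprP (x i); have Ij := subq_reprP (y (n - i)%N).
have le_in : (i <= n)%N by rewrite -ltnS.
rewrite -(subq_class0 (ideal_exp I n) (ideal_exp I n.+1)).
apply/subq_class_eq; [|exact: ideal0|rewrite subr0].
  by have := ideal_expD Ii Ij; rewrite subnKC.
have [le_Ni|lt_iN] := leqP N i.
  have Ii' := subq_repr_eq0 (xN _ le_Ni).
  by have := ideal_expD Ii' Ij; rewrite addSn subnKC.
have Ij' : ideal_exp I (n - i).+1 (subq_repr (y (n - i)%N)).
  apply: subq_repr_eq0; apply: yM; rewrite leq_subRL //.
  by apply: leq_trans le_n; rewrite leq_add2r ltnW.
by have := ideal_expD Ii Ij'; rewrite addnS subnKC.
Defined.

Lemma gr_class_eq n a b : ideal_exp I n a -> ideal_exp I n b ->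
  gr_class n a = gr_class n b <-> ideal_exp I n.+1 (a - b).
Proof. exact: subq_class_eq. Qed.

Lemma gr_classM (i j : nat) n (a a' b b' : A) : (i + j = n)%N ->
  ideal_exp I i a -> ideal_exp I i a' -> ideal_exp I j b -> ideal_exp I j b' ->
  gr_class i a = gr_class i a' -> gr_class j b = gr_class j b' ->
  gr_class n (a * b) = gr_class n (a' * b').
Proof.
move=> <- Ia Ia' Ib Ib' /gr_class_eq-/(_ Ia Ia') ea /gr_class_eq-/(_ Ib Ib') eb.
apply/gr_class_eq; [exact: ideal_expD|exact: ideal_expD|].
have -> : a * b - a' * b' = (a - a') * b + a' * (b - b') by ring.
apply: idealD; first by rewrite -addSn; exact: ideal_expD.
by rewrite -addnS; exact: ideal_expD.
Qed.

Lemma rees_coef (g : rees_ring I) (n : nat) : ideal_exp I n (val g)@_(n : int).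
Proof. by have /fil_predP/(_ n) := valP g. Qed.

Lemma rees_coefN (g : rees_ring I) (n : nat) : (val g)@_(Negz n) = 0.
Proof. by have /fil_predP/(_ (Negz n)) := valP g. Qed.

(* The ring axioms are transported from the Rees ring, which [gr_proj] maps  *)
(* onto [gr].                                                                 *)
Definition gr_proj (g : rees_ring I) : gr.
Proof.
exists (fun n => gr_class n (val g)@_(n : int)).
exists (\max_(k <- msupp (val g)) `|k|.+1)%N => n le_n.
suff -> : (val g)@_(n : int) = 0 by exact: subq_class0.
apply: mcoeff_outdom; apply/negP => ng; move: le_n.
rewrite (big_fsetD1 _ ng) /= geq_max => /andP[].
by rewrite ltnn.
Defined.

Lemma gr_proj_surj x : exists g, gr_proj g = x.
Proof.
have [N xN] := gr_finite x.
pose g : laurent A := \sum_(i < N) << subq_repr (x i) *g (i : nat)%:Z >>.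
have gE (k : int) : g@_k = \sum_(i < N) subq_repr (x i) *+ (i%:Z == k).
  by rewrite raddf_sum; apply: eq_bigr => i _; rewrite /= mcoeffU.
have gI : g \in fil_pred (rees_fil I).
  apply/fil_predP => n; rewrite gE; apply: ideal_sum => i _ _.
  by case: eqP => [<-|_]; [exact: subq_reprP|exact: ideal0].
exists (exist _ g gI : rees_ring I); apply: grP => n; rewrite /= gE.
have [lt_nN|le_Nn] := ltnP n N.
  rewrite (bigD1 (Ordinal lt_nN)) //= eqxx big1 ?addr0 ?mulr1n.
    by rewrite /gr_class subq_reprK.
  by move=> i /eqP ni; case: eqP => // -[e]; case: ni; exact: val_inj.
rewrite big1 ?xN //; first exact: subq_class0.
by move=> i _; case: eqP => // -[e]; move: (ltn_ord i); rewrite e ltnNge le_Nn.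
Qed.

Lemma gr_projD f g : gr_proj (f + g) = gr_proj f + gr_proj g.
Proof.
apply: grP => n; rewrite /= mcoeffD.
by apply: subq_classD; exact: rees_coef.
Qed.

Lemma gr_proj1 : gr_proj 1 = gr_one.
Proof.
apply: grP => n; rewrite /= -[X in mcoeff _ X]/(1 : laurent A) laurent1_coef.
by case: n => [//|n]; exact: subq_class0.
Qed.

Lemma rees_coefM (f g : rees_ring I) (n : nat) : (val (f * g))@_(n : int) =
  \sum_(i < n.+1) (val f)@_(i%:Z) * (val g)@_((n - i)%N%:Z).
Proof.
pose D : {fset int} := [fset (i : nat)%:Z | i in iota 0 n.+1]%fset.
rewrite rmorphM /= (laurentM_coef _ _ (fsubsetUl (msupp (val f)) D)).
transitivity (\sum_(k <- D) (val f)@_k * (val g)@_(n%:Z - k)).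
  apply/esym/big_fset_incl => [|k _ kD]; first exact: fsubsetUr.
  case: k kD => k kD; last by rewrite rees_coefN mul0r.
  have {kD}lt_nk : (n < k)%N.
    rewrite ltnNge; apply/negP => le_kn; case/negP: kD.
    have ki : k \in iota 0 n.+1 by rewrite mem_iota add0n ltnS.
    by apply/imfsetP; exists k.
  rewrite -[k](subnKC lt_nk) PoszD; set j := (k - n.+1)%N.
  have -> : n%:Z - (n.+1%:Z + j%:Z) = Negz j by rewrite NegzE; lia.
  by rewrite rees_coefN mulr0.
transitivity (\sum_(0 <= i < n.+1) (val f)@_(i%:Z) * (val g)@_(n%:Z - i%:Z)).
  rewrite big_imfset; last by move=> i j _ _ [].
  by rewrite /index_iota subn0 -[in RHS](undup_id (iota_uniq 0 n.+1)).
rewrite big_mkord.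
by apply: eq_bigr => i _; rewrite subzn // -ltnS.
Qed.

Lemma gr_class_sum n (m : nat) (F : 'I_m -> A) :
  (forall i, ideal_exp I n (F i)) ->
  gr_class n (\sum_i F i) = \sum_i gr_class n (F i).
Proof.
move=> FI; pose R a (x : gr_piece n) := ideal_exp I n a /\ gr_class n a = x.
suff [] : R (\sum_i F i) (\sum_i gr_class n (F i)) by [].
apply: big_ind2 => [|a x b y [Ia <-] [Ib <-]|i _].
- by split; [exact: ideal0|exact: subq_class0].
- by split; [exact: idealD|exact: subq_classD].
- by split.
Qed.

Lemma gr_projM f g : gr_proj (f * g) = gr_mul (gr_proj f) (gr_proj g).
Proof.
apply: grP => n.
have h (i : 'I_n.+1) : (i + (n - i) = n)%N by rewrite subnKC // -ltnS.
rewrite /= -[X in mcoeff _ X]/(val (f * g)) rees_coefM gr_class_sum.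
  apply: eq_bigr => i _; apply: (gr_classM (h i)); try exact: rees_coef.
  1,2: exact: subq_reprP.
  1,2: by rewrite [RHS]subq_reprK.
by move=> i; rewrite -[X in ideal_exp I X](h i); apply: ideal_expD; exact: rees_coef.
Qed.

Lemma gr_mulA : associative gr_mul.
Proof.
move=> x y z; have [f <-] := gr_proj_surj x; have [g <-] := gr_proj_surj y.
by have [h <-] := gr_proj_surj z; rewrite -!gr_projM mulrA.
Qed.

Lemma gr_mulC : commutative gr_mul.
Proof.
move=> x y; have [f <-] := gr_proj_surj x; have [g <-] := gr_proj_surj y.
by rewrite -!gr_projM mulrC.
Qed.

Lemma gr_mul1 : left_id gr_one gr_mul.
Proof.
by move=> x; have [f <-] := gr_proj_surj x; rewrite -gr_proj1 -gr_projM mul1r.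
Qed.

Lemma gr_mulDl : left_distributive gr_mul +%R.
Proof.
move=> x y z; have [f <-] := gr_proj_surj x; have [g <-] := gr_proj_surj y.
have [h <-] := gr_proj_surj z.
by rewrite -gr_projD -!gr_projM -gr_projD mulrDl.
Qed.

HB.instance Definition _ :=
  GRing.Zmodule_isComPzRing.Build gr gr_mulA gr_mulC gr_mul1 gr_mulDl.

End AssociatedGraded.

Section Tensor.
Variable B : comPzRingType.
Implicit Types M N P : lmodType B.

Definition subgroup (V : zmodType) (H : set V) :=
  H 0 /\ forall x y, H x -> H y -> H (x - y).

(* [{malg int[(M * N)%type]}] is the free abelian group on [M * N]. *)
Definition tensor_rel M N : set {malg int[(M * N)%type]} :=
  [set u | (exists m m' n, u = << (m + m', n) >> - << (m, n) >> - << (m', n) >>)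
        \/ (exists m n n', u = << (m, n + n') >> - << (m, n) >> - << (m, n') >>)
        \/ (exists b m n, u = << (b *: m, n) >> - << (m, b *: n) >>)].

Definition tensor_pred M N : {pred {malg int[(M * N)%type]}} := fun u =>
  `[< forall H, subgroup H -> @tensor_rel M N `<=` H -> H u >].

Lemma tensor_pred_zmod_closed M N : zmod_closed (@tensor_pred M N).
Proof.
split=> [|x y /asboolP Hx /asboolP Hy]; apply/asboolP => H sH RH.
  by case: sH.
by case: (sH) => _; apply; [exact: Hx|exact: Hy].
Qed.
HB.instance Definition _ M N := GRing.isZmodClosed.Build
  {malg int[(M * N)%type]} (@tensor_pred M N) (@tensor_pred_zmod_closed M N).

Definition tensor M N := Quotient.quot (@tensor_pred M N).
HB.instance Definition _ M N := GRing.Zmodule.on (tensor M N).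

Definition tens M N (m : M) (n : N) : tensor M N :=
  \pi_(tensor M N) << (m, n) >>.

Definition free_map M M' N (g : M -> M') (u : {malg int[(M * N)%type]}) :
  {malg int[(M' * N)%type]} := \sum_(k <- msupp u) << u@_k *g (g k.1, k.2) >>.

(* the map $g \otimes N$ from $M \otimes N$ to $M' \otimes N$ *)
Definition tensor_map M M' N (g : M -> M') (u : tensor M N) : tensor M' N :=
  \pi_(tensor M' N) (free_map g (repr u)).

Lemma free_mapw M M' N (g : M -> M') (u : {malg int[(M * N)%type]}) (d : {fset M * N}) :
  (msupp u `<=` d)%fset ->
  free_map g u = \sum_(k <- d) << u@_k *g (g k.1, k.2) >>.
Proof.
move=> le_ud; apply: big_fset_incl => // k _ /mcoeff_outdom ->.
exact: monalgU0.
Qed.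

Lemma free_mapB M M' N (g : M -> M') :
  zmod_morphism (@free_map M M' N g).
Proof.
move=> u v; rewrite (free_mapw g (msuppB_le u v)).
rewrite (free_mapw g (fsubsetUl (msupp u) (msupp v))).
rewrite (free_mapw g (fsubsetUr (msupp u) (msupp v))) -sumrB.
by apply: eq_bigr => k _; rewrite mcoeffB monalgUB.
Qed.
HB.instance Definition _ M M' N (g : M -> M') :=
  GRing.isZmodMorphism.Build {malg int[(M * N)%type]} {malg int[(M' * N)%type]}
    (@free_map M M' N g) (@free_mapB M M' N g).

Lemma free_mapU M M' N (g : M -> M') (c : int) (k : M * N) :
  free_map g << c *g k >> = << c *g (g k.1, k.2) >>.
Proof. by rewrite (free_mapw g msuppU_le) big_seq_fset1 mcoeffUU. Qed.

Lemma tensor_pi_eq M N (u v : {malg int[(M * N)%type]}) :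
  \pi_(tensor M N) u = \pi_(tensor M N) v <-> u - v \in @tensor_pred M N.
Proof. by split=> [/eqP|h]; [|apply/eqP]; rewrite -Quotient.idealrBE. Qed.

Lemma free_map_tensor M M' N (g : {linear M -> M'}) (u : {malg int[(M * N)%type]}) :
  u \in @tensor_pred M N -> free_map g u \in @tensor_pred M' N.
Proof.
move=> /asboolP/(_ [set v | free_map g v \in @tensor_pred M' N]); apply.
  split=> [|x y Tx Ty] /=; first by rewrite raddf0 rpred0.
  by rewrite raddfB rpredB.
move=> _ [[m [m' [n ->]]]|[[m [n [n' ->]]]|[b [m [n ->]]]]];
  rewrite /= !raddfB /= !free_mapU /=; apply/asboolP => H _; apply.
- by left; exists (g m), (g m'), n; rewrite linearD.
- by right; left; exists (g m), n, n'.
- by right; right; exists b, (g m), n; rewrite linearZ.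
Qed.

Lemma tensor_map_pi M M' N (g : {linear M -> M'}) (u : {malg int[(M * N)%type]}) :
  tensor_map g (\pi_(tensor M N) u) = \pi_(tensor M' N) (free_map g u).
Proof.
apply/tensor_pi_eq; rewrite -raddfB; apply: free_map_tensor.
by apply/tensor_pi_eq; rewrite reprK.
Qed.

Lemma tensor_map_tens M M' N (g : {linear M -> M'}) (m : M) (n : N) :
  tensor_map g (tens m n) = tens (g m) n.
Proof. by rewrite tensor_map_pi free_mapU. Qed.

Lemma tensor_mapD M M' N (g : {linear M -> M'}) :
  {morph @tensor_map M M' N g : u v / u + v}.
Proof.
move=> u v; rewrite -[u]reprK -[v]reprK -[_ + _](raddfD (\pi_(tensor M N))).
by rewrite !tensor_map_pi raddfD /= [LHS]raddfD.
Qed.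

End Tensor.

Definition exact_at (U V W : zmodType) (g : U -> V) (h : V -> W) :=
  forall y, h y = 0 <-> exists x, g x = y.

(* [A] as a [B]-module, by restriction of scalars along [f]. *)
Definition restrict (B A : comPzRingType) (f : {rmorphism B -> A}) : Type := A.

Section Restrict.
Variables (B A : comPzRingType) (f : {rmorphism B -> A}).
HB.instance Definition _ := GRing.Zmodule.on (restrict f).

Definition restrict_scale (b : B) (a : restrict f) : restrict f := f b * (a : A).

Lemma restrict_scaleA a b (v : restrict f) :
  restrict_scale a (restrict_scale b v) = restrict_scale (a * b) v.
Proof. by rewrite /restrict_scale rmorphM mulrA. Qed.

Lemma restrict_scale1 : left_id 1 restrict_scale.
Proof. by move=> v; rewrite /restrict_scale rmorph1 mul1r. Qed.

Lemma restrict_scaleDr : right_distributive restrict_scale +%R.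
Proof. by move=> a u v; exact: mulrDr. Qed.

Lemma restrict_scaleDl (v : restrict f) :
  {morph restrict_scale^~ v : a b / a + b}.
Proof. by move=> a b; rewrite /restrict_scale rmorphD; exact: mulrDl. Qed.

HB.instance Definition _ := GRing.Zmodule_isLmodule.Build B (restrict f)
  restrict_scaleA restrict_scale1 restrict_scaleDr restrict_scaleDl.

Definition faithfully_flat :=
  forall (M N P : lmodType B) (g : {linear M -> N}) (h : {linear N -> P}),
    exact_at g h <->
    exact_at (@tensor_map B M N (restrict f) g)
             (@tensor_map B N P (restrict f) h).

Definition finite_type := exists s : seq A, forall T : set A,
  T 1 -> (forall x y, T x -> T y -> T (x - y)) ->
  (forall x y, T x -> T y -> T (x * y)) ->
  (forall b, T (f b)) -> (forall x, x \in s -> T x) -> forall a, T a.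

End Restrict.

(* A decomposition of [A] as the direct sum of the subgroups [gcomp n].  The  *)
(* elements of [{malg A[int]}] are used as finitely supported families.       *)
Record grading (A : comPzRingType) := Grading {
  gcomp :> int -> A -> Prop;
  gcomp_subgroup : forall n, subgroup (gcomp n : set A);
  gcompM : forall m n x y, gcomp m x -> gcomp n y -> gcomp (m + n) (x * y);
  gcomp_direct : forall a, exists! c : {malg A[int]},
    (forall n, gcomp n c@_n) /\ a = \sum_(n <- msupp c) c@_n }.

Section Graded.
Variables (A : comPzRingType) (G : grading A).
Implicit Types I m : ideal A.

Definition homogeneous_ideal I := forall c : {malg A[int]},
  (forall n, G n c@_n) -> I (\sum_(n <- msupp c) c@_n) -> forall n, I c@_n.

Definition graded_maximal_ideal m :=
  [/\ homogeneous_ideal m, proper m &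
      forall J, homogeneous_ideal J -> proper J -> m `<=` J -> J `<=` m].

End Graded.

Record noetherian_subcategory := NoetherianSubcategory {
  obj :> comPzRingType -> Prop;
  hom : forall A B : comPzRingType, {rmorphism A -> B} -> Prop;
  obj_noetherian : forall A, obj A -> noetherian A;
  hom_obj : forall (A B : comPzRingType) (f : {rmorphism A -> B}), hom f -> obj A /\ obj B;
  hom_id : forall A, obj A -> @hom A A idfun;
  hom_comp : forall (A B C : comPzRingType) (f : {rmorphism A -> B}) (g : {rmorphism B -> C}),
    hom f -> hom g -> hom (g \o f) }.

Record closure_conditions (D : noetherian_subcategory) : Prop := {
  closed_finite_type : forall (A B : comPzRingType) (f : {rmorphism A -> B}),
    D A -> finite_type f -> D B;
  closed_localization : forall (A : comPzRingType) (S : set A),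
    D A -> multiplicative_set S -> D (localization S);
  closed_faithfully_flat : forall (A B : comPzRingType) (f : {rmorphism B -> A}),
    D A -> injective f -> faithfully_flat f -> D B;
  closed_rees : forall (A : comPzRingType) (I : ideal A),
    D A -> D (rees_ring I);
  closed_ext_rees : forall (A : comPzRingType) (I : ideal A),
    D A -> D (ext_rees_ring I) }.

Definition ring_isomorphic (A B : comPzRingType) :=
  exists f : {rmorphism A -> B}, bijective f.

(* Only the values of [P] on the objects of [D] are relevant. *)
Definition ring_theoretic_property (D : noetherian_subcategory)
    (P : comPzRingType -> Prop) :=
  forall A B, D A -> D B -> ring_isomorphic A B -> P A <-> P B.

(* Main.v *)
(* Let [S = A[It, t^-1]] and [u = t^-1], a nonzerodivisor of [S] with
   [S/uS = G(I)].  Since [A] is local and [I] lies in [m], the only graded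
   maximal ideal of [S] is the prime [M] of the elements whose coefficient of
   degree 0 lies in [m]; it contains [u].  By (a), the localization
   [S_M/uS_M] of [G(I)] has P, hence so does [S_M] by (c), and [S] by (d).
   Every localization of [A[t, t^-1] = S_u] at a prime is a localization of [S]
   at a prime, so [A[t, t^-1]] has P by (a), and [A] has P by (b), because
   [A[t, t^-1]] is free over [A]. *)
From HB Require Import structures.
From mathcomp Require Import all_boot all_order all_algebra finmap.
From mathcomp Require Import boolp classical_sets.
From mathcomp.multinomials Require Import monalg.
From mathcomp Require Import ring zify.
Require Import Defs.

Set Implicit Arguments.
Unset Strict Implicit.
Unset Printing Implicit Defensive.

Import GRing.Theory Num.Theory.
Import Quotient.Exports.

Local Open Scope quotient_scope.
Local Open Scope classical_set_scope.
Local Open Scope ring_scope.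

(** * Ideals and localizations *)

Lemma bij_of_inj_surj (A B : Type) (f : A -> B) :
  injective f -> (forall y, exists x, f x = y) -> bijective f.
Proof.
move=> f_inj /choice[g fgK]; exists g => // x.
by apply: f_inj; rewrite fgK.
Qed.

Section IdealTheory.
Variable A : comPzRingType.
Implicit Types (I J p m : ideal A) (x y : A).

Definition adjoin_ideal I x : ideal A.
Proof.
exists [set z | exists2 a, I a & exists b, z = a + b * x].
- by exists 0; [exact: ideal0|exists 0; rewrite mul0r addr0].
- move=> _ _ [a Ia [b ->]] [a' Ia' [b' ->]].
  exists (a + a'); first exact: idealD.
  by exists (b + b'); rewrite mulrDl addrACA.
- move=> c _ [a Ia [b ->]]; exists (c * a); first exact: idealMl.
  by exists (c * b); rewrite mulrDr mulrA.
Defined.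

(** If $x \notin m$, then $1 = a + bx$ with $a \in m$, so $y = ay + b(xy)$ lies in $m$ as soon as
    $xy$ does. *)
Lemma maximal_prime m : maximal_ideal m -> prime_ideal m.
Proof.
move=> [m1 m_max]; split=> // x y mxy; have [|mx] := EM (m x); first by left.
right; have [J1|J1] := EM (adjoin_ideal m x 1); last first.
  case: mx; apply: (m_max _ J1) => [a ma|]; last first.
    by exists 0; [exact: ideal0|exists 1; rewrite mul1r add0r].
  by exists a => //; exists 0; rewrite mul0r addr0.
have [a ma [b e]] := J1.
rewrite -[y]mul1r e mulrDl -mulrA.
by apply: idealD; [exact: idealMr|exact: idealMl].
Qed.

Lemma proper_sub_maximal I : proper I ->
  exists2 n : ideal A, maximal_ideal n & I `<=` n.
Proof.
move=> I1.
(* The empty set makes the family stable under unions of empty chains. *)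
pose F (X : set A) := X = set0 \/
  exists2 J : ideal A, proper J & I `<=` J /\ X = J :> set A.
have [G GF Gchain|X [FX X_max]] := @Zorn_bigcup A F.
  have [[Y GY [y Yy]]|G0] := EM (exists2 Y, G Y & Y !=set0); last first.
    left; apply/seteqP; split=> // x [Y GY Yx].
    by case: G0; exists Y => //; exists x.
  right.
  have idG Z z : G Z -> Z z ->
      exists2 J : ideal A, proper J & I `<=` J /\ Z = J :> set A.
    by move=> GZ Zz; case: (GF _ GZ) => // Z0; move: Zz; rewrite Z0.
  have [K K1 [IK YK]] := idG _ _ GY Yy.
  have U0 : (\bigcup_(X in G) X) 0 by exists Y => //; rewrite YK; exact: ideal0.
  have UD x z : (\bigcup_(X in G) X) x -> (\bigcup_(X in G) X) z ->
      (\bigcup_(X in G) X) (x + z).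
    move=> [S GS Sx] [T GT Tz].
    have [JS _ [_ eS]] := idG _ _ GS Sx; have [JT _ [_ eT]] := idG _ _ GT Tz.
    have [ST|TS] := Gchain _ _ GS GT.
      by exists T => //; have := ST _ Sx; move: Tz; rewrite eT => ? ?; exact: idealD.
    by exists S => //; have := TS _ Tz; move: Sx; rewrite eS; exact: idealD.
  have UM a x : (\bigcup_(X in G) X) x -> (\bigcup_(X in G) X) (a * x).
    move=> [S GS Sx]; exists S => //.
    have [JS _ [_ eS]] := idG _ _ GS Sx.
    by move: Sx; rewrite eS; exact: idealMl.
  exists (Ideal U0 UD UM) => [[S GS S1]|].
    by have [JS JS1 [_ eS]] := idG _ _ GS S1; apply: JS1; rewrite -eS.
  by split=> // x Ix; exists Y => //; rewrite YK; exact: IK.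
(* The maximal member is not the empty set, since [I] is a strictly larger member of [F]. *)
case: FX => [X0|[J J1 [IJ XJ]]].
  have FI : F I by right; exists I; [|split].
  case: (X_max _ _ FI); rewrite X0; split=> // /(_ 0); apply; exact: ideal0.
exists J => //; split=> // K K1 JK x Kx; apply: contrapT => Jx.
have FK : F K by right; exists K; [|split=> [y /IJ/JK|]].
case: (X_max _ _ FK); rewrite XJ; split=> // /(_ _ Kx); exact: Jx.
Qed.

Lemma local_proper_sub m I : local_ring m -> proper I -> I `<=` m.
Proof.
by move=> [_ m_uniq] /proper_sub_maximal[n /m_uniq <-].
Qed.

(** An element outside [m] is a unit and lies in no proper ideal, so [m] contains every proper
    ideal. *)
Lemma local_of_units m : proper m ->
  (forall x, ~ m x -> exists y, y * x = 1) -> local_ring m.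
Proof.
move=> m1 m_unit; have sub_m J : proper J -> J `<=` m.
  move=> J1 x Jx; apply: contrapT => /m_unit[y yx].
  by apply: J1; rewrite -yx; exact: idealMl.
have m_max : maximal_ideal m by split=> // J /sub_m.
split=> // n [n1 n_max]; apply/seteqP; split; first exact: sub_m.
by apply: n_max => //; exact: sub_m.
Qed.

Lemma prime_setC_mul p : prime_ideal p -> multiplicative_set (~` p).
Proof. by move=> [p1 pM]; split=> [//|x y px py /pM[]]. Qed.

End IdealTheory.

(** * Inverse and direct images of ideals; quotient rings *)

Section Morphisms.
Variables (A B : comPzRingType) (f : {rmorphism A -> B}).

Definition preim_ideal (J : ideal B) : ideal A.
Proof.
exists [set x | J (f x)] => [|x y|a x] /=.
- by rewrite rmorph0; exact: ideal0.
- by rewrite rmorphD; exact: idealD.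
- by rewrite rmorphM; exact: idealMl.
Defined.

Lemma preim_ideal_prime (J : ideal B) :
  prime_ideal J -> prime_ideal (preim_ideal J).
Proof.
by move=> [J1 JM]; split=> [|x y] /=; rewrite /proper /= ?rmorph1 ?rmorphM //; exact: JM.
Qed.

Hypothesis f_surj : forall y, exists x, f x = y.

Definition image_ideal (J : ideal A) : ideal B.
Proof.
exists (f @` J) => [|_ _ [x Jx <-] [y Jy <-]|b _ [x Jx <-]].
- by exists 0; [exact: ideal0|rewrite rmorph0].
- by exists (x + y); [exact: idealD|rewrite rmorphD].
- have [a <-] := f_surj b.
  by exists (a * x); [exact: idealMl|rewrite rmorphM].
Defined.

Section ImageIdeal.
Variable J : ideal A.
Hypothesis kerJ : forall x, f x = 0 -> J x.

Lemma preim_imageK : preim_ideal (image_ideal J) = J :> set A.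
Proof.
apply/seteqP; split=> [x [y Jy fyx]|x Jx]; last by exists x.
rewrite -[x](subrK y); apply: idealD => //.
by apply: kerJ; rewrite rmorphB fyx subrr.
Qed.

Lemma image_ideal_prime : prime_ideal J -> prime_ideal (image_ideal J).
Proof.
have imE x : image_ideal J (f x) <-> J x by rewrite -[in X in _ <-> X]preim_imageK.
move=> [J1 JM]; split=> [|x y]; first by rewrite /proper -(rmorph1 f) imE.
have [a <-] := f_surj x; have [b <-] := f_surj y.
by rewrite -rmorphM !imE; exact: JM.
Qed.

End ImageIdeal.

Lemma surj_finite_type : finite_type f.
Proof.
by exists [::] => T T1 TB TM Tf _ y; have [x <-] := f_surj y.
Qed.

(** First isomorphism theorem. The induced map evaluates [f] at the chosen representative; as [I] is
    the kernel, the value depends only on the class. *)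
Lemma quotient_isomorphic (I : ideal A) :
  (forall x, f x = 0 <-> I x) -> ring_isomorphic (quotient_ring I) B.
Proof.
move=> kerf; pose g (x : quotient_ring I) : B := f (repr x).
have gE x : g (qclass I x) = f x.
  apply/eqP; rewrite /g -subr_eq0 -rmorphB; apply/eqP/kerf/qclass_eq.
  exact: qclassK.
have gB : zmod_morphism g.
  move=> x y; rewrite -[x]qclassK -[y]qclassK !gE -rmorphB -gE.
  by congr g; rewrite /qclass !piE.
have gM : monoid_morphism g.
  split; first by rewrite -(rmorph1 f); exact: gE.
  move=> x y; rewrite -[x]qclassK -[y]qclassK.
  rewrite [X in g X](qmulE I (repr x) (repr y)).
  by rewrite !gE rmorphM.
pose aM := GRing.isZmodMorphism.Build _ _ g gB.
pose mM := GRing.isMonoidMorphism.Build _ _ g gM.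
pose G : {rmorphism quotient_ring I -> B} := HB.pack g aM mM.
exists G; apply: bij_of_inj_surj => [x y|y] /=.
  rewrite -[x]qclassK -[y]qclassK !gE => e; apply/qclass_eq/kerf.
  by rewrite rmorphB e subrr.
by have [x <-] := f_surj y; exists (qclass I x); rewrite gE.
Qed.

End Morphisms.

(** Through this surjective morphism a quotient is a finitely generated algebra, hence stays in
    $\mathbf{D}$. *)
Lemma qclass_rmorphism (A : comPzRingType) (I : ideal A) :
  exists2 f : {rmorphism A -> quotient_ring I}, f =1 @qclass A I &
    forall y, exists x, f x = y.
Proof.
have cB : zmod_morphism (@qclass A I) by move=> x y; rewrite /qclass !piE.
have cM : monoid_morphism (@qclass A I).
  by split=> // x y; rewrite -qmulE.
pose aM := GRing.isZmodMorphism.Build _ _ (@qclass A I) cB.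
pose mM := GRing.isMonoidMorphism.Build _ _ (@qclass A I) cM.
pose G : {rmorphism A -> quotient_ring I} := HB.pack (@qclass A I) aM mM.
by exists G => // y; exists (repr y); exact: qclassK.
Qed.

(** * Fractions, localizations at primes, and maps between localizations *)

Section LocalizationTheory.
Variables (A : comPzRingType) (S : set A).
Local Notation L := (localization S).
Implicit Types (a b : A) (s t : denominator S).

Lemma fracD a s b t :
  frac a s + frac b t = frac (a * dval t + b * dval s) (denM s t).
Proof. exact: locDE. Qed.

Lemma fracN a s : - frac a s = frac (- a) s.
Proof. exact: locNE. Qed.

Lemma fracM a s b t : frac a s * frac b t = frac (a * b) (denM s t).
Proof. exact: locME. Qed.

Lemma frac_eq0 a s : frac a s = 0 <-> exists2 u, mul_closure S u & u * a = 0.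
Proof.
rewrite -[0]/(frac 0 (den1 S)).
split=> [/frac_eq[u Su]|[u Su e]].
  by rewrite dval1 mulr1 mul0r mulr0 => e; exists u.
by apply/frac_eq; exists u => //; rewrite dval1 mulr1 mul0r mulr0.
Qed.

Lemma frac_unit s t : frac (dval t) s * frac (dval s) t = 1.
Proof.
rewrite fracM -[1]/(frac 1 (den1 S)); apply: frac_eqw.
by rewrite dval1 dvalM mulr1 mul1r mulrC.
Qed.

Lemma localizationP (x : L) : exists a s, x = frac a s.
Proof. by exists (num x), (den x); rewrite fracK. Qed.

Lemma frac_nonzerodivisor y : nonzerodivisor y ->
  nonzerodivisor (frac y (den1 S)).
Proof.
move=> y_reg x; have [a [s ->]] := localizationP x.
rewrite fracM => /frac_eq0[u Su]; rewrite mulrCA => /y_reg e.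
by apply/frac_eq0; exists u.
Qed.

End LocalizationTheory.

Section LocalizationAtPrime.
Variables (A : comPzRingType) (p : ideal A).
Hypothesis p_prime : prime_ideal p.
Local Notation L := (localization (~` p)).

Lemma prime_denominatorP (s : denominator (~` p)) : ~ p (dval s).
Proof.
by have := denominatorP s; rewrite mul_closure_id //; exact: prime_setC_mul.
Qed.

Lemma prime_mul_closure x : ~ p x -> mul_closure (~` p) x.
Proof. by rewrite mul_closure_id //; exact: prime_setC_mul. Qed.

(** Equality of the fractions means $u(at) = u(bs)$ with $u, s \notin p$; primality cancels $u$ and
    $s$. Hence membership of the numerator in $p$ depends only on the fraction. *)
Lemma prime_frac_num (a b : A) (s t : denominator (~` p)) :
  frac a s = frac b t -> p a -> p b.
Proof.
case: p_prime => _ pM /frac_eq[u]; rewrite mul_closure_id; last first.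
  exact: prime_setC_mul.
move=> pu e pa; have : p (u * (b * dval s)).
  by rewrite -e; apply: idealMl; exact: idealMr.
by move=> /pM[//|/pM[//|/prime_denominatorP]].
Qed.

(** The ideal $pA_p$, read off the chosen numerator; [loc_max_frac] allows any other way of writing
    the fraction. *)
Definition loc_max : ideal L.
Proof.
exists [set x | p (num x)] => [|x y|a x] /=.
- apply: (@prime_frac_num 0 _ (den1 _) _ (esym (fracK (0 : L)))).
  exact: ideal0.
- move=> px py; apply: (prime_frac_num (esym (fracK (x + y)))).
  by apply: idealD; exact: idealMr.
- move=> px; apply: (prime_frac_num (esym (fracK (a * x)))).
  exact: idealMl.
Defined.

Lemma loc_max_frac a s : loc_max (frac a s) <-> p a.
Proof.
have e := fracK (frac a s).
by split; [exact: (prime_frac_num e)|exact: (prime_frac_num (esym e))].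
Qed.

Lemma loc_max_local : local_ring loc_max.
Proof.
apply: local_of_units.
  by case: p_prime => p1 _ /(loc_max_frac 1 (den1 _)).
move=> x; have [a [s ->]] := localizationP x; rewrite loc_max_frac => pa.
exists (frac (dval s) (den_mk (prime_mul_closure pa))).
by rewrite mulrC; exact: (@frac_unit _ _ s (den_mk (prime_mul_closure pa))).
Qed.

End LocalizationAtPrime.

Section LocalizationMap.
Variables (A B : comPzRingType) (f : {rmorphism A -> B}) (S : set A) (T : set B).
Hypothesis fST : forall x, S x -> T (f x).

Lemma mul_closure_map x : mul_closure S x -> mul_closure T (f x).
Proof.
move=> [s sS ->]; exists [seq f y | y <- s].
  by move=> _ /mapP[y /sS/fST Ty ->].
by rewrite rmorph_prod big_map.
Qed.

Definition den_map (s : denominator S) : denominator T :=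
  den_mk (mul_closure_map (denominatorP s)).

Lemma dval_map s : dval (den_map s) = f (dval s). Proof. by []. Qed.

Definition loc_map (x : localization S) : localization T :=
  frac (f (num x)) (den_map (den x)).

Lemma loc_mapE a s : loc_map (frac a s) = frac (f a) (den_map s).
Proof.
have /frac_eq[u Su e] := fracK (frac a s).
apply/frac_eq; exists (f u); first exact: mul_closure_map.
by rewrite -!rmorphM e.
Qed.

Lemma loc_mapB : zmod_morphism loc_map.
Proof.
move=> x y; have [a [s ->]] := localizationP x.
have [b [t ->]] := localizationP y.
rewrite fracN fracD !loc_mapE fracN fracD; apply: frac_eqw.
by rewrite !(dvalM, dval_map) !(rmorphM, rmorphD, rmorphN).
Qed.

Lemma loc_mapM : monoid_morphism loc_map.
Proof.
split.
  rewrite -[1]/(frac 1 (den1 S)) loc_mapE -[1 in RHS]/(frac 1 (den1 T)).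
  by apply: frac_eqw; rewrite dval_map !dval1 rmorph1.
move=> x y; have [a [s ->]] := localizationP x.
have [b [t ->]] := localizationP y.
rewrite fracM !loc_mapE fracM; apply: frac_eqw.
by rewrite !(dvalM, dval_map) !(rmorphM, rmorphD, rmorphN).
Qed.

HB.instance Definition _ := GRing.isZmodMorphism.Build _ _ loc_map loc_mapB.
HB.instance Definition _ := GRing.isMonoidMorphism.Build _ _ loc_map loc_mapM.

End LocalizationMap.

Section LocalizationAtPreimage.
Variables (A B : comPzRingType) (f : {rmorphism A -> B}) (p : ideal B).
Hypothesis p_prime : prime_ideal p.
Local Notation q := (preim_ideal f p).

Lemma preim_setC x : (~` q) x -> (~` p) (f x).
Proof. by []. Qed.

Local Notation F := (loc_map preim_setC).

(** Localization commutes with the quotient by $y$: the map $A_q \to B_p$ induced by $f$ is onto,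
    because denominators lift along $f$ to elements outside $q$, and its kernel is generated by
    $y/1$. *)
Lemma loc_quotient_isomorphic y : (forall b, exists a, f a = b) ->
  (forall x, f x = 0 <-> principal y x) ->
  ring_isomorphic (quotient_ring (principal (frac y (den1 (~` q)))))
    (localization (~` p)).
Proof.
move=> f_surj kerf; have q_prime := preim_ideal_prime f p_prime.
have f_loc (t : denominator (~` p)) : exists s : denominator (~` q), f (dval s) = dval t.
  have [s fs] := f_surj (dval t); have qs : ~ q s.
    by rewrite /= fs; exact: prime_denominatorP.
  by exists (den_mk (prime_mul_closure q_prime qs)).
apply: (@quotient_isomorphic _ _ F) => z.
  have [b [t ->]] := localizationP z.
  have [a <-] := f_surj b; have [s fs] := f_loc t.
  by exists (frac a s); rewrite /= loc_mapE; apply: frac_eqw; rewrite -fs.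
split=> [|[x ->]].
  have [a [s ->]] := localizationP z.
  rewrite /= loc_mapE => /frac_eq0[v Tv]; rewrite -[v]/(dval (den_mk Tv)).
  have [w <-] := f_loc (den_mk Tv).
  (* With $v = f(w)$, the relation $f(wa) = 0$ gives $wa = yb$, hence $a/s = (y/1)(b/(ws))$. *)
  rewrite -rmorphM => /kerf[b e]; exists (frac b (denM w s)).
  by rewrite fracM; apply: frac_eqw; rewrite -e !dvalM dval1; ring.
rewrite rmorphM /= loc_mapE.
suff e s : frac (f y) s = 0 :> localization (~` p) by rewrite e mul0r.
apply/frac_eq0; exists 1; first exact: mul_closure1.
by rewrite mul1r; apply/kerf; exists 1; rewrite mulr1.
Qed.

(* The last hypothesis makes [B] a localization of [A]. *)
Lemma loc_preim_isomorphic : injective f ->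
  (forall b, exists s a, f s * b = f a /\ exists c, c * f s = 1) ->
  ring_isomorphic (localization (~` q)) (localization (~` p)).
Proof.
move=> f_inj f_frac; have q_prime := preim_ideal_prime f p_prime.
exists F; apply: bij_of_inj_surj.
  apply/raddf_inj => x; have [a [s ->]] := localizationP x.
  rewrite /= loc_mapE => /frac_eq0[v]; rewrite mul_closure_id; last first.
    exact: prime_setC_mul.
  (* Here $f(w)v = f(b)$ with $f(w)$ invertible. So $b \notin q$ because $v \notin p$, and $v f(a) =
     0$ gives $f(ba) = 0$, whence $ba = 0$. *)
  have [w [b [ewb [c ecw]]]] := f_frac v.
  move=> pv e; apply/frac_eq0; exists b.
    apply: (prime_mul_closure q_prime) => /=; rewrite -ewb => pwv; apply: pv.
    by rewrite -[v]mul1r -ecw -mulrA; exact: idealMl.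
  by apply: f_inj; rewrite rmorphM -ewb -mulrA e mulr0 rmorph0.
move=> y; have [b [t ->]] := localizationP y.
have [s1 [a1 [e1 [c1 u1]]]] := f_frac b.
have [s2 [a2 [e2 [c2 u2]]]] := f_frac (dval t).
have qd : ~ q (s1 * a2).
  rewrite /= rmorphM -e2 => pd; apply: (prime_denominatorP p_prime (s := t)).
  have -> : dval t = c1 * c2 * (f s1 * (f s2 * dval t)).
    transitivity (c1 * f s1 * (c2 * f s2) * dval t); last by ring.
    by rewrite u1 u2 !mul1r.
  exact: idealMl.
(* From $f(s_1) b = f(a_1)$ and $f(s_2) t = f(a_2)$ one reads $b/t = f(s_2 a_1)/f(s_1 a_2)$. *)
exists (frac (s2 * a1) (den_mk (prime_mul_closure q_prime qd))).
rewrite /= loc_mapE; apply: frac_eqw; rewrite dval_map.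
by rewrite !rmorphM -e1 -e2; ring.
Qed.

End LocalizationAtPreimage.

(** * Tensor products and flatness of the Laurent polynomials *)

Section TensorTheory.
Variables (B : comPzRingType) (M N : lmodType B).
Implicit Types (m : M) (n : N) (x y : tensor M N).

Lemma tensDl m m' n : tens (m + m') n = tens m n + tens m' n.
Proof.
rewrite /tens -[RHS](raddfD (\pi_(tensor M N))) /=.
apply/tensor_pi_eq; apply/asboolP => H _; apply; left; exists m, m', n.
by rewrite opprD addrA.
Qed.

Lemma tensDr m n n' : tens m (n + n') = tens m n + tens m n'.
Proof.
rewrite /tens -[RHS](raddfD (\pi_(tensor M N))) /=.
apply/tensor_pi_eq; apply/asboolP => H _; apply; right; left.
by exists m, n, n'; rewrite opprD addrA.
Qed.

Lemma tensZ b m n : tens (b *: m) n = tens m (b *: n).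
Proof.
by apply/tensor_pi_eq; apply/asboolP => H _; apply; right; right; exists b, m, n.
Qed.

Lemma tens0l n : tens (0 : M) n = 0.
Proof. by apply: (addIr (tens 0 n)); rewrite -tensDl !add0r. Qed.

Lemma tens0r m : tens m (0 : N) = 0.
Proof. by apply: (addIr (tens m 0)); rewrite -tensDr !add0r. Qed.

(** Every tensor is an integral combination of pure tensors, and closure under differences already
    yields zero, opposites and sums. *)
Lemma tensor_ind (Q : tensor M N -> Prop) :
  (forall x y, Q x -> Q y -> Q (x - y)) -> (forall m n, Q (tens m n)) ->
  forall x, Q x.
Proof.
move=> QB Qt x; have Q0 : Q 0 by rewrite -(subrr (tens 0 0)); exact: QB.
have QN y : Q y -> Q (- y) by move=> Qy; rewrite -sub0r; exact: QB.
have QD y z : Q y -> Q z -> Q (y + z) by move=> Qy /QN Qz; rewrite -[z]opprK; exact: QB.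
rewrite -[x]reprK [repr x]monalgE raddf_sum /=; apply: big_ind => // k _.
move: (repr x)@_k => c.
have nat_case (j : nat) : Q (\pi_(tensor M N) << (j : int) *g k >>).
  elim: j => [|j IHj]; first by rewrite monalgU0 raddf0.
  rewrite -addn1 PoszD monalgUD raddfD; apply: QD => //.
  by case: k {IHj} => m n; exact: Qt.
by case: c => j //; rewrite NegzE monalgUN raddfN; exact/QN/nat_case.
Qed.

Section Lift.
Variables (V : zmodType) (F : M -> N -> V).
Hypotheses (FDl : forall m m' n, F (m + m') n = F m n + F m' n)
  (FDr : forall m n n', F m (n + n') = F m n + F m n')
  (FZ : forall b m n, F (b *: m) n = F m (b *: n)).

Definition bilin_eval (u : {malg int[(M * N)%type]}) : V :=
  \sum_(k <- msupp u) F k.1 k.2 *~ u@_k.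

Lemma bilin_evalw (d : {fset M * N}) u : (msupp u `<=` d)%fset ->
  bilin_eval u = \sum_(k <- d) F k.1 k.2 *~ u@_k.
Proof.
move=> le_ud; apply: big_fset_incl => // k _ /mcoeff_outdom ->.
exact: mulr0z.
Qed.

Lemma bilin_evalB : zmod_morphism bilin_eval.
Proof.
move=> u v; rewrite (bilin_evalw (msuppB_le u v)).
rewrite (bilin_evalw (fsubsetUl (msupp u) (msupp v))).
rewrite (bilin_evalw (fsubsetUr (msupp u) (msupp v))) -sumrB.
by apply: eq_bigr => k _; rewrite mcoeffB mulrzBr.
Qed.
HB.instance Definition _ := GRing.isZmodMorphism.Build
  {malg int[(M * N)%type]} V bilin_eval bilin_evalB.

Lemma bilin_evalU k : bilin_eval << k >> = F k.1 k.2.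
Proof. by rewrite (bilin_evalw msuppU_le) big_seq_fset1 mcoeffUU. Qed.

(** The zeros of [bilin_eval] form a subgroup containing the defining relations, while [tensor_pred]
    is the smallest such subgroup. *)
Lemma bilin_eval_tensor u : u \in @tensor_pred B M N -> bilin_eval u = 0.
Proof.
move=> /asboolP/(_ [set v | bilin_eval v = 0]); apply.
  by split=> [|x y /= Hx Hy]; rewrite /= ?raddf0 // raddfB /= Hx Hy subrr.
by move=> _ [[m [m' [n ->]]]|[[m [n [n' ->]]]|[b [m [n ->]]]]];
  rewrite /= !raddfB /= !bilin_evalU /= ?FDl ?FDr ?FZ ?subrr // addrAC addrK subrr.
Qed.

(** The universal property of the tensor product for balanced biadditive maps; the target is only an
    abelian group. *)
Definition tensor_lift x : V := bilin_eval (repr x).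

Lemma tensor_lift_pi u : tensor_lift (\pi_(tensor M N) u) = bilin_eval u.
Proof.
apply/eqP; rewrite -subr_eq0 -raddfB; apply/eqP/bilin_eval_tensor.
by apply/tensor_pi_eq; rewrite reprK.
Qed.

Lemma tensor_liftB : zmod_morphism tensor_lift.
Proof.
move=> x y; rewrite -[x]reprK -[y]reprK -[_ - _](raddfB (\pi_(tensor M N))).
by rewrite !tensor_lift_pi raddfB.
Qed.
Lemma tensor_lift_tens m n : tensor_lift (tens m n) = F m n.
Proof. by rewrite /tens tensor_lift_pi bilin_evalU. Qed.

End Lift.
End TensorTheory.

(** * Laurent polynomials as an algebra and as a module over the constants *)

Section LaurentConst.
Variable A : comPzRingType.

Definition laurent_const (a : A) : laurent A := << a *g 0%:Z >>.

Lemma laurent_constB : zmod_morphism laurent_const.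
Proof. by move=> a b; exact: monalgUB. Qed.

Lemma laurent_constM : monoid_morphism laurent_const.
Proof.
by split=> // a b; rewrite -[RHS]/(lmul _ _) lmulUU addr0.
Qed.

HB.instance Definition _ :=
  GRing.isZmodMorphism.Build A (laurent A) laurent_const laurent_constB.
HB.instance Definition _ :=
  GRing.isMonoidMorphism.Build A (laurent A) laurent_const laurent_constM.

Lemma laurent_const_inj : injective laurent_const.
Proof. by move=> a b /(congr1 (mcoeff 0)); rewrite !mcoeffUU. Qed.

Lemma laurent_mulUU (a b : A) (k l : int) :
  (<< a *g k >> : laurent A) * << b *g l >> = << a * b *g k + l >>.
Proof. exact: lmulUU. Qed.

Lemma laurent_mulU_coef (a : A) (k n : int) (g : laurent A) :
  ((<< a *g k >> : laurent A) * g)@_n = a * g@_(n - k).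
Proof. by rewrite (laurentM_coef _ _ msuppU_le) big_seq_fset1 mcoeffUU. Qed.

(** The generators are $t$ and $t^{-1}$: a monomial is a constant times a power of one of them. *)
Lemma laurent_finite_type : finite_type laurent_const.
Proof.
exists [:: << 1 *g 1 >>; << 1 *g - 1 >>] => T T1 TB TM Tc Ts.
have T0 : T 0 by rewrite -(subrr 1); exact: TB.
have TD x y : T x -> T y -> T (x + y).
  by move=> Tx Ty; rewrite -[y]opprK -[- y]sub0r; apply: (TB) => //; exact: TB.
elim/laurent_ind => // c k.
have -> : << c *g k >> = laurent_const c * << 1 *g k >> :> laurent A.
  by rewrite laurent_mulUU mulr1 add0r.
apply: (TM); first exact: Tc.
have Tpow (e : int) (j : nat) : T << 1 *g e >> -> T << 1 *g e *+ j >>.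
  move=> Te; elim: j => [|j IHj]; first exact: T1.
  by rewrite mulrS -[1]mulr1 -laurent_mulUU; exact: TM.
case: k => j.
  by rewrite -[j%:Z]natz; apply: (Tpow); apply: Ts; rewrite inE eqxx.
rewrite NegzE -[j.+1%:Z]natz -mulNrn.
by apply: Tpow; apply: Ts; rewrite !inE eqxx orbT.
Qed.

End LaurentConst.

Section LaurentFlat.
Variable A : comPzRingType.
Local Notation L := (restrict (@laurent_const A)).
Implicit Types M N P : lmodType A.

Definition tpow (n : int) : L := << 1 *g n >> : laurent A.

Lemma laurent_scale_coef (a : A) (g : L) n :
  (a *: g : laurent A)@_n = a * (g : laurent A)@_n.
Proof. by rewrite -[a *: g]/((<< a *g 0%:Z >> : laurent A) * (g : laurent A)) laurent_mulU_coef subr0. Qed.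

Section Coef.
Variable M : lmodType A.

Definition coef_scale n (m : M) (g : L) : M := (g : laurent A)@_n *: m.

Lemma coef_scaleDl n m m' g :
  coef_scale n (m + m') g = coef_scale n m g + coef_scale n m' g.
Proof. exact: scalerDr. Qed.

Lemma coef_scaleDr n m g g' :
  coef_scale n m (g + g') = coef_scale n m g + coef_scale n m g'.
Proof. by rewrite /coef_scale -scalerDl -mcoeffD. Qed.

Lemma coef_scaleZ n b m g : coef_scale n (b *: m) g = coef_scale n m (b *: g).
Proof. by rewrite /coef_scale laurent_scale_coef scalerA mulrC. Qed.

(** The projection of $M \otimes A[t, t^{-1}] = \bigoplus_n M t^n$ onto its summand of degree
    $n$. *)
Definition tensor_coef n : tensor M L -> M := tensor_lift (coef_scale n).
HB.instance Definition _ n := GRing.isZmodMorphism.Build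
  (tensor M L) M (tensor_coef n)
  (tensor_liftB (coef_scaleDl n) (coef_scaleDr n) (@coef_scaleZ n)).

Lemma tensor_coef_tens n m g : tensor_coef n (tens m g) = (g : laurent A)@_n *: m.
Proof.
exact: (tensor_lift_tens (coef_scaleDl n) (coef_scaleDr n) (@coef_scaleZ n)).
Qed.

Lemma tensor_coef_tpow n m k : tensor_coef n (tens m (tpow k)) = m *+ (k == n).
Proof. by rewrite tensor_coef_tens mcoeffU; case: eqP; rewrite ?scale1r ?scale0r. Qed.

(** For a pure tensor, $m \otimes c t^k = cm \otimes t^k$. The formula is asked for every [e]
    containing [d] so that the expansions of two tensors can be subtracted over a common index
    set. *)
Lemma tensor_expand (x : tensor M L) : exists d : {fset int},
  forall e : {fset int}, (d `<=` e)%fset ->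
  x = \sum_(n <- e) tens (tensor_coef n x) (tpow n).
Proof.
have tensB m m' g : tens (m - m') g = tens m g - tens m' g :> tensor M L.
  by apply: (addIr (tens m' g)); rewrite -tensDl !subrK.
pose E (u : tensor M L) := exists d : {fset int},
  forall e : {fset int}, (d `<=` e)%fset ->
  u = \sum_(n <- e) tens (tensor_coef n u) (tpow n).
have E0 : E 0.
  by exists fset0 => e _; rewrite big1 // => n _; rewrite raddf0 tens0l.
have EB u v : E u -> E v -> E (u - v).
  move=> [d dx] [d' dy]; exists (d `|` d')%fset => e.
  rewrite fsubUset => /andP[/dx ex /dy ey].
  transitivity (\sum_(n <- e) tens (tensor_coef n u) (tpow n) -
                \sum_(n <- e) tens (tensor_coef n v) (tpow n)).
    by congr (_ - _).
  by rewrite -sumrB; apply: eq_bigr => n _; rewrite raddfB tensB.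
rewrite -/(E x); elim/tensor_ind: x => [|m g]; first exact: EB.
elim/laurent_ind: g => [|g g' Eg Eg'|c k].
- by rewrite tens0r.
- rewrite (tensDr m (g : L) g') -[tens m (g' : L)]opprK -[- tens _ _]sub0r.
  exact: (EB _ _ Eg (EB _ _ E0 Eg')).
exists [fset k]%fset => e; rewrite fsub1set => ke.
have tk : (<< c *g k >> : laurent A) = c *: tpow k.
  by rewrite -[RHS]/((<< c *g 0%:Z >> : laurent A) * << 1 *g k >>) laurent_mulUU mulr1 add0r.
rewrite tk -tensZ (big_fsetD1 k) //= tensor_coef_tpow eqxx.
rewrite big1_fset ?addr0 // => n; rewrite !inE => /andP[nk _] _.
by rewrite tensor_coef_tpow eq_sym (negPf nk) tens0l.
Qed.

Lemma tensor_coef_eq0 (x : tensor M L) :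
  (forall n, tensor_coef n x = 0) -> x = 0.
Proof.
move=> x0; have [d /(_ _ (fsubset_refl _)) ->] := tensor_expand x.
by rewrite big1 // => n _; rewrite x0 tens0l.
Qed.

End Coef.

Lemma tensor_coef_map M N (g : {linear M -> N}) n (x : tensor M L) :
  tensor_coef n (tensor_map g x) = g (tensor_coef n x).
Proof.
elim/tensor_ind: x => [x y IHx IHy|m f]; last first.
  by rewrite tensor_map_tens !tensor_coef_tens linearZ.
have -> : tensor_map g (x - y) = tensor_map g x - tensor_map g y.
  by apply: (addIr (tensor_map g y)); rewrite -tensor_mapD !subrK.
by rewrite !raddfB /= IHx IHy.
Qed.

Lemma tensor_map_sum M N (g : {linear M -> N}) (e : {fset int})
    (F : int -> tensor M L) :
  tensor_map g (\sum_(n <- e) F n) = \sum_(n <- e) tensor_map g (F n).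
Proof.
apply: (big_morph (tensor_map g)); first exact: tensor_mapD.
by rewrite -(tens0l M (0 : L)) tensor_map_tens raddf0 tens0l.
Qed.

(* $M \otimes_A A[t, t^{-1}]$ is $\bigoplus_n M t^n$, naturally in $M$. *)
Lemma laurent_faithfully_flat : faithfully_flat (@laurent_const A).
Proof.
move=> M N P g h; split=> [gh y|gh y].
  split=> [hy|[x <-]].
    (* Exactness is lifted degree by degree: each coefficient of $y$ gets a preimage under $g$, and
       finitely many of them are reassembled. *)
    have /choice[x gx] n : exists x, g x = tensor_coef n y.
      by apply/gh; rewrite -tensor_coef_map hy raddf0.
    have [d /(_ _ (fsubset_refl _)) ->] := tensor_expand y.
    exists (\sum_(n <- d) tens (x n) (tpow n)).
    by rewrite tensor_map_sum; apply: eq_bigr => n _; rewrite tensor_map_tens gx.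
  apply: tensor_coef_eq0 => n; rewrite !tensor_coef_map.
  by apply/gh; exists (tensor_coef n x).
(* Conversely, a module embeds as the summand of degree $0$ by $z \mapsto z \otimes 1$, and
   exactness is read off there. *)
have coef0 (z : P) : tens z (tpow 0) = 0 -> z = 0.
  by move=> /(congr1 (tensor_coef 0)); rewrite tensor_coef_tpow raddf0.
split=> [hy|[x <-]].
  have [x gx] : exists x, @tensor_map A M N L g x = tens y (tpow 0).
    by apply/gh; rewrite tensor_map_tens hy tens0l.
  exists (tensor_coef 0 x).
  by rewrite -tensor_coef_map gx tensor_coef_tpow.
apply: coef0; rewrite -tensor_map_tens; apply/gh.
by exists (tens x (tpow 0)); rewrite tensor_map_tens.
Qed.

End LaurentFlat.

(** * The extended Rees ring *)

Section ExtendedRees.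
Variables (A : comPzRingType) (I : ideal A).
Local Notation S := (ext_rees_ring I).
Local Notation E := (ext_rees_ideal I).
Implicit Types f g : S.

Definition rees_incl (f : S) : laurent A := val f.

Lemma rees_inclB : zmod_morphism rees_incl. Proof. exact: raddfB. Qed.

Lemma rees_inclM : monoid_morphism rees_incl.
Proof. by split=> [|f g]; rewrite /rees_incl ?rmorph1 ?rmorphM. Qed.

HB.instance Definition _ :=
  GRing.isZmodMorphism.Build S (laurent A) rees_incl rees_inclB.
HB.instance Definition _ :=
  GRing.isMonoidMorphism.Build S (laurent A) rees_incl rees_inclM.

Lemma rees_incl_inj : injective rees_incl. Proof. exact: val_inj. Qed.

Definition rcoef n f : A := (rees_incl f)@_n.

Lemma rcoefB n : zmod_morphism (rcoef n).
Proof. by move=> f g; rewrite /rcoef (raddfB rees_incl) mcoeffB. Qed.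

HB.instance Definition _ n :=
  GRing.isZmodMorphism.Build S A (rcoef n) (rcoefB n).

Lemma rcoefP n f : E n (rcoef n f).
Proof. by have /fil_predP/(_ n) := valP f. Qed.

Lemma rcoef_ext f g : (forall n, rcoef n f = rcoef n g) -> f = g.
Proof. by move=> fg; apply/rees_incl_inj/malgP. Qed.

Lemma rcoefM (d : {fset int}) n f g : (msupp (rees_incl f) `<=` d)%fset ->
  rcoef n (f * g) = \sum_(k <- d) rcoef k f * rcoef (n - k) g.
Proof. by move=> le_d; rewrite /rcoef (rmorphM rees_incl) (laurentM_coef _ _ le_d). Qed.

Lemma monomial_in_rees n a : E n a -> << a *g n >> \in fil_pred (ext_rees_fil I).
Proof.
move=> Ea; apply/fil_predP => k; rewrite mcoeffU.
by case: eqP => [<-|_]; [exact: Ea|exact: ideal0].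
Qed.

Definition rmono n a (Ea : E n a) : S :=
  exist _ (<< a *g n >> : laurent A) (monomial_in_rees Ea).

Lemma rcoef_mono n a (Ea : E n a) k : rcoef k (rmono Ea) = a *+ (n == k).
Proof. exact: mcoeffU. Qed.

Lemma rcoef_monoM n a (Ea : E n a) k f :
  rcoef k (rmono Ea * f) = a * rcoef (k - n) f.
Proof. by rewrite /rcoef (rmorphM rees_incl); exact: laurent_mulU_coef. Qed.

Definition rees_const (a : A) : S := @rmono 0 a Logic.I.

Lemma rees_constB : zmod_morphism rees_const.
Proof.
by move=> a b; apply: rcoef_ext => n; rewrite raddfB /= !rcoef_mono mulrnBl.
Qed.

Lemma rees_constM : monoid_morphism rees_const.
Proof.
split=> [|a b]; apply: rcoef_ext => n; first by rewrite /rcoef (rmorph1 rees_incl).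
by rewrite rcoef_monoM !rcoef_mono subr0 mulrnAr.
Qed.

HB.instance Definition _ :=
  GRing.isZmodMorphism.Build A S rees_const rees_constB.
HB.instance Definition _ :=
  GRing.isMonoidMorphism.Build A S rees_const rees_constM.

(** [Negz 0] is the degree $-1$, where the ideal is the whole ring. *)
Definition tinv : S := @rmono (Negz 0) 1 Logic.I.

Lemma rcoef_tinvM k f : rcoef k (tinv * f) = rcoef (k + 1) f.
Proof. by rewrite rcoef_monoM mul1r NegzE opprK. Qed.

Lemma tinv_nonzerodivisor : nonzerodivisor tinv.
Proof.
move=> f uf0; apply: rcoef_ext => n; rewrite raddf0.
by rewrite -[n](subrK 1) -rcoef_tinvM uf0 raddf0.
Qed.

(** A large enough power of $t^{-1}$, a unit of $A[t, t^{-1}]$, multiplies $b$ into the extended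
    Rees ring. In this form $A[t, t^{-1}] = S_u$ is fed to [loc_preim_isomorphic]. *)
Lemma rees_laurent_frac (b : laurent A) : exists s a,
  rees_incl s * b = rees_incl a /\ exists c, c * rees_incl s = 1.
Proof.
elim/laurent_ind: b => [|b b'|c [j|j]].
- exists 1, 0; rewrite rmorph1 raddf0 mulr0.
  by split=> //; exists 1; rewrite mulr1.
- move=> [s [a [e [c ec]]]] [s' [a' [e' [c' ec']]]].
  exists (s * s'), (s' * a + s * a'); split.
    by rewrite !(rmorphD, rmorphM) /= -e -e'; ring.
  exists (c * c'); rewrite rmorphM mulrACA ec ec'; exact: mulr1.
- have Es : E (- j%:Z) 1 by case: j.
  exists (rmono Es), (rees_const c).
  split; first by rewrite [LHS]laurent_mulUU mul1r addNr.
  by exists << 1 *g j%:Z >>; rewrite [LHS]laurent_mulUU mul1r addrN.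
- exists 1, (@rmono (Negz j) c Logic.I); rewrite rmorph1 mul1r.
  by split=> //; exists 1; rewrite mulr1.
Qed.

(** * The grading of the extended Rees ring and its graded maximal ideal *)

Definition rees_gcomp n f : Prop := forall k, k != n -> rcoef k f = 0.

Lemma rees_gcomp_subgroup n : subgroup (rees_gcomp n : set S).
Proof.
split=> [k _|f g fn gn k kn]; first exact: raddf0.
by rewrite raddfB /= fn ?gn ?subrr.
Qed.

Lemma rees_gcompM i j f g :
  rees_gcomp i f -> rees_gcomp j g -> rees_gcomp (i + j) (f * g).
Proof.
move=> fi gj k kij; rewrite (rcoefM _ _ (fsubset_refl _)) big1 // => l _.
have [->|/fi->] := eqVneq l i; last by rewrite mul0r.
rewrite [rcoef (k - i) g]gj ?mulr0 //; apply: contra kij => /eqP <-.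
by rewrite subrKC.
Qed.

Definition rees_component n f : S := rmono (rcoefP n f).

Definition rees_components f : {malg S[int]} :=
  \sum_(n <- msupp (rees_incl f)) << rees_component n f *g n >>.

Lemma rees_components_coef f n : (rees_components f)@_n = rees_component n f.
Proof.
rewrite raddf_sum /=; have [nf|nf] := boolP (n \in msupp (rees_incl f)).
  rewrite (big_fsetD1 n) //= mcoeffU eqxx big1_fset ?addr0 // => k.
  by rewrite !inE mcoeffU => /andP[/negPf->].
rewrite big1_fset => [|k kf _]; last first.
  rewrite mcoeffU; by case: eqP => // kn; rewrite -kn kf in nf.
apply: rcoef_ext => k; rewrite rcoef_mono raddf0.
by rewrite /rcoef (mcoeff_outdom nf) mul0rn.
Qed.

(** Only the summand of degree $k$ contributes to the coefficient of $t^k$. This gives uniqueness of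
    the decomposition and the homogeneity of [rees_max]. *)
Lemma rees_gcomp_sum_coef (c : {malg S[int]}) k :
  (forall n, rees_gcomp n c@_n) ->
  rcoef k (\sum_(n <- msupp c) c@_n) = rcoef k c@_k.
Proof.
move=> cP; rewrite raddf_sum /=; have [kc|kc] := boolP (k \in msupp c).
  rewrite (big_fsetD1 k) //= big1_fset ?addr0 // => n.
  by rewrite !inE eq_sym => /andP[kn _] _; exact: cP.
rewrite (mcoeff_outdom kc) raddf0 big1_fset // => n nc _.
by apply: cP; apply: contraNneq kc => ->.
Qed.

Lemma rees_components_gcomp f n : rees_gcomp n (rees_components f)@_n.
Proof.
by move=> k kn; rewrite rees_components_coef rcoef_mono eq_sym (negPf kn).
Qed.

Lemma rees_components_sum f :
  f = \sum_(n <- msupp (rees_components f)) (rees_components f)@_n.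
Proof.
apply: rcoef_ext => k; rewrite rees_gcomp_sum_coef; last first.
  exact: rees_components_gcomp.
by rewrite rees_components_coef rcoef_mono eqxx.
Qed.

Lemma rees_gcomp_direct f : exists! c : {malg S[int]},
  (forall n, rees_gcomp n c@_n) /\ f = \sum_(n <- msupp c) c@_n.
Proof.
exists (rees_components f); split.
  by split; [exact: rees_components_gcomp|exact: rees_components_sum].
move=> c [cP fc]; apply/malgP => n; apply: rcoef_ext => k.
rewrite rees_components_coef rcoef_mono; have [<-|nk] := eqVneq n k.
  by rewrite mulr1n fc rees_gcomp_sum_coef.
by rewrite cP // eq_sym.
Qed.

Definition rees_grading : grading S :=
  Grading rees_gcomp_subgroup rees_gcompM rees_gcomp_direct.

Section GradedMaximal.
Variable m : ideal A.
Hypotheses (m_local : local_ring m) (Im : I `<=` m).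

Lemma ext_rees_pos (n : int) a : 0 < n -> E n a -> m a.
Proof.
case: n => [[//|j]|//] _ [s sI ->]; apply: ideal_sum => x /sI[Ix _] _.
by apply: idealMr; exact: Im.
Qed.

(** The difference is the sum of the $f_k g_{-k}$ with $k \neq 0$; one factor has positive degree,
    so its coefficient lies in $I \subseteq m$. *)
Lemma rcoef0M f g : m (rcoef 0 (f * g) - rcoef 0 f * rcoef 0 g).
Proof.
(* The index $0$ is added to the support so that its term can be split off even when $f_0 = 0$. *)
rewrite (rcoefM _ _ (fsubsetUl _ [fset 0%:Z]%fset)).
rewrite (big_fsetD1 0%:Z) /=; last by rewrite !inE eqxx orbT.
rewrite subr0 addrAC subrr add0r; apply: ideal_sum => k.
rewrite !inE => /andP[k0 _] _; have [kn|kp|/eqP] := ltrgtP k 0.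
- by apply/idealMl/(ext_rees_pos _ (rcoefP _ g)); rewrite sub0r oppr_gt0.
- exact/idealMr/(ext_rees_pos kp (rcoefP _ f)).
- by rewrite (negPf k0).
Qed.

(** The kernel of the map to $A/m$ given by $f \mapsto f_0$, which [rcoef0M] makes
    multiplicative. *)
Definition rees_max : ideal S.
Proof.
exists [set f | m (rcoef 0 f)] => [|f g|f g] /=.
- by rewrite raddf0; exact: ideal0.
- by rewrite raddfD; exact: idealD.
- move=> mg; rewrite -[rcoef 0 _](subrK (rcoef 0 f * rcoef 0 g)).
  by apply: idealD; [exact: rcoef0M|exact: idealMl].
Defined.

Lemma rees_max_prime : prime_ideal rees_max.
Proof.
have [m1 mM] := maximal_prime m_local.1.
split=> [|f g mfg]; rewrite /proper /=.
  by rewrite -(rmorph1 rees_const) rcoef_mono.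
apply: mM; rewrite -[_ * _](subKr (rcoef 0 (f * g))).
by apply: idealB => //; exact: rcoef0M.
Qed.

Lemma rees_max_homogeneous : homogeneous_ideal rees_grading rees_max.
Proof.
move=> c cP; rewrite /= rees_gcomp_sum_coef // => mc n.
have [<-//|n0] := eqVneq 0 n.
by rewrite (cP n 0 n0); exact: ideal0.
Qed.

(** The constants in $J$ form a proper ideal of the local ring $A$, hence lie in $m$; by homogeneity
    $J$ contains the degree $0$ component of each of its elements. *)
Lemma homogeneous_sub_rees_max (J : ideal S) :
  homogeneous_ideal rees_grading J -> proper J -> J `<=` rees_max.
Proof.
move=> hJ J1 f Jf.
have J1' : proper (preim_ideal rees_const J) by rewrite /proper /= rmorph1.
apply: (local_proper_sub m_local J1') => /=.
have := hJ _ (rees_components_gcomp f).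
rewrite -rees_components_sum => /(_ Jf 0); rewrite rees_components_coef.
congr (ideal_set J _); apply: rcoef_ext => n.
by rewrite !rcoef_mono.
Qed.

Lemma graded_maximalE (J : ideal S) :
  graded_maximal_ideal rees_grading J -> J = rees_max :> set S.
Proof.
move=> [hJ J1 Jmax]; have sub := homogeneous_sub_rees_max hJ J1.
apply/seteqP; split=> //; apply: Jmax => //; last exact: rees_max_prime.1.
exact: rees_max_homogeneous.
Qed.

End GradedMaximal.

(* Truncation [A[It, t^-1] -> A[It]] is multiplicative only modulo [I A[It]], that
   is, after projection to [gr I]. *)
Definition laurent_trunc (g : laurent A) : laurent A :=
  \sum_(k <- msupp g | 0 <= k) << g@_k *g k >>.

Lemma laurent_trunc_coef (g : laurent A) n :
  (laurent_trunc g)@_n = if 0 <= n then g@_n else 0.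
Proof.
rewrite raddf_sum /= big_mkcond /=.
have [ng|ng] := boolP (n \in msupp g).
  rewrite (big_fsetD1 n) //= mcoeffU eqxx big1_fset ?addr0 // => k.
  by rewrite !inE mcoeffU => /andP[/negPf-> _] _; case: ifP.
rewrite (mcoeff_outdom ng) if_same big1_fset // => k kg _.
by rewrite mcoeffU; case: eqP => [kn|_]; [rewrite -kn kg in ng|case: ifP].
Qed.

Lemma rees_truncP f : laurent_trunc (rees_incl f) \in fil_pred (rees_fil I).
Proof.
apply/fil_predP => -[n|n]; rewrite laurent_trunc_coef //.
exact: (rcoefP n f).
Qed.

Definition rees_trunc f : rees_ring I :=
  exist _ (laurent_trunc (rees_incl f)) (rees_truncP f).

Definition rees_gr f : gr I := gr_proj (rees_trunc f).

Lemma rees_gr_coef f (n : nat) : rees_gr f n = gr_class I n (rcoef n f).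
Proof. by rewrite /= laurent_trunc_coef. Qed.

Lemma gr_class_eq0 n a : ideal_exp I n a ->
  gr_class I n a = 0 <-> ideal_exp I n.+1 a.
Proof.
move=> Ia; rewrite -[0](subq_class0 (ideal_exp I n) (ideal_exp I n.+1)).
by rewrite -[X in _ <-> ideal_set _ X]subr0; apply: gr_class_eq => //; exact: ideal0.
Qed.

Lemma rees_grD f g : rees_gr (f + g) = rees_gr f + rees_gr g.
Proof.
apply: grP => n; rewrite -[RHS]/(rees_gr f n + rees_gr g n) !rees_gr_coef.
by rewrite raddfD; apply: subq_classD; exact: (rcoefP n).
Qed.

Lemma rees_grB : zmod_morphism rees_gr.
Proof.
by move=> f g; apply: (addIr (rees_gr g)); rewrite -rees_grD !subrK.
Qed.

Lemma rees_grM : monoid_morphism rees_gr.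
Proof.
split.
  apply: grP => -[|n]; rewrite rees_gr_coef /rcoef rmorph1 laurent1_coef //.
  exact: subq_class0.
move=> f g; rewrite -[RHS]gr_projM; apply: grP => n; rewrite rees_gr_coef.
set h := rees_trunc f * rees_trunc g.
have hE : val h = laurent_trunc (rees_incl f) * laurent_trunc (rees_incl g) by [].
apply/gr_class_eq; [exact: (rcoefP n)|exact: rees_coef|rewrite hE].
rewrite (rcoefM _ _ (fsubsetUl _ (msupp (laurent_trunc (rees_incl f))))).
rewrite (laurentM_coef _ _ (fsubsetUr (msupp (rees_incl f)) _)) -sumrB.
apply: ideal_sum => k _ _; rewrite !laurent_trunc_coef.
have fP := rcoefP k f; have gP := rcoefP (n%:Z - k) g.
(* The two products differ by the terms $f_k g_{n-k}$ in which one index is negative. The other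
   index is then at least $n + 1$, so the term lies in $I^{n+1}$. *)
case: (lerP 0 k) => k0.
  case: (lerP 0 (n%:Z - k)) => nk; first by rewrite subrr; exact: ideal0.
  rewrite mulr0 subr0; apply: idealMr.
  apply: (@ext_rees_ideal_le _ I n.+1%:Z k) => //; lia.
rewrite mul0r subr0; apply: idealMl.
apply: (@ext_rees_ideal_le _ I n.+1%:Z (n%:Z - k)) => //; lia.
Qed.

HB.instance Definition _ := GRing.isZmodMorphism.Build S (gr I) rees_gr rees_grB.
HB.instance Definition _ :=
  GRing.isMonoidMorphism.Build S (gr I) rees_gr rees_grM.

Lemma rees_gr_surj x : exists f, rees_gr f = x.
Proof.
have [g <-] := gr_proj_surj x.
have gP : val g \in fil_pred (ext_rees_fil I).
  by apply/fil_predP => -[n|n] //; exact: rees_coef.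
by exists (exist _ (val g) gP : S); apply: grP => n; rewrite rees_gr_coef.
Qed.

(** The image of $f$ vanishes when $f_n \in I^{n+1}$ for all $n \ge 0$, which is exactly the
    condition for $tf$ to lie in $S$; then $f = u \cdot tf$. *)
Lemma rees_gr_ker f : rees_gr f = 0 <-> principal tinv f.
Proof.
split=> [f0|[g ->]]; last first.
  apply: grP => n; rewrite rees_gr_coef; apply/gr_class_eq0.
    exact: (rcoefP n).
  by rewrite rcoef_tinvM -PoszD addn1; exact: (rcoefP n.+1).
have gP : (<< 1 *g 1 >> : laurent A) * rees_incl f \in fil_pred (ext_rees_fil I).
  (* In degrees at most $0$ there is nothing to check; in degree $n + 1$ the coefficient of $tf$ is
     $f_n$. *)
  apply/fil_predP => -[[|n]|n] //; rewrite laurent_mulU_coef mul1r.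
  have -> : n.+1%:Z - 1 = n by lia.
  apply/gr_class_eq0; first exact: (rcoefP n).
  by rewrite -rees_gr_coef f0.
exists (exist _ (_ : laurent A) gP : S); apply: rcoef_ext => n; rewrite rcoef_tinvM.
by rewrite /rcoef [RHS]laurent_mulU_coef mul1r addrK.
Qed.

End ExtendedRees.

(** * Descent of the property from [gr I] to $S$, then to $A[t, t^{-1}]$ and $A$ *)

Theorem proposition3p5
  (D : noetherian_subcategory) (hD : closure_conditions D)
  (P : comPzRingType -> Prop) (hP : ring_theoretic_property D P)
  (ha : forall A : comPzRingType, D A ->
     (P A <-> forall p : ideal A, prime_ideal p -> P (localization (~` p))))
  (hb : forall (A B : comPzRingType) (f : {rmorphism B -> A}),
     D A -> injective f -> faithfully_flat f -> P A -> P B)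
  (hc : forall (A : comPzRingType) (m : ideal A) (y : A),
     D A -> local_ring m -> m y -> nonzerodivisor y ->
     P (quotient_ring (principal y)) -> P A)
  (hd : forall (A : comPzRingType) (G : grading A), D A ->
     (P A <-> forall m : ideal A, graded_maximal_ideal G m ->
                P (localization (~` m))))
  (A : comPzRingType) (m I : ideal A) :
  D A -> local_ring m -> I `<=` m -> P (gr I) -> P A.
Proof.
move=> DA m_local Im PG; pose S := ext_rees_ring I.
have DS : D S := closed_ext_rees hD I DA.
have gr_surj := @rees_gr_surj A I.
have DG : D (gr I) := closed_finite_type hD DS (surj_finite_type gr_surj).
have PS : P S.
  apply: (hd _ (rees_grading I) DS).2 => J /(graded_maximalE m_local Im) JE.
  have J_prime : prime_ideal J.
    by have := rees_max_prime m_local Im; rewrite /prime_ideal /proper JE.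
  have Ju : J (tinv I).
    by rewrite JE /= rcoef_mono; exact: ideal0.
  have kerJ f : rees_gr f = 0 -> J f.
    by move=> /rees_gr_ker[g ->]; exact: idealMr.
  have N_prime := image_ideal_prime gr_surj kerJ J_prime.
  (* As $J$ contains the kernel $uS$, it is the preimage of its image $N$ in [gr I]; in this form
     $S_J/uS_J$ can be identified with the localization of [gr I] at $N$. *)
  rewrite -(preim_imageK gr_surj kerJ).
  set N := image_ideal _ _ in N_prime *.
  have q_prime := preim_ideal_prime (@rees_gr A I) N_prime.
  have Dq := closed_localization hD DS (prime_setC_mul q_prime).
  have DN := closed_localization hD DG (prime_setC_mul N_prime).
  pose y : localization (~` preim_ideal (@rees_gr A I) N) := frac (tinv I) (den1 _).
  apply: (hc _ _ y Dq (loc_max_local q_prime)).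
  - by apply/loc_max_frac; exists (tinv I).
  - exact/frac_nonzerodivisor/tinv_nonzerodivisor.
  (* Invariance under isomorphism is available only inside $\mathbf{D}$, so the quotient by $y$ must
     first be shown to belong to it. *)
  have [c _ c_surj] := qclass_rmorphism (principal y).
  have Dy := closed_finite_type hD Dq (surj_finite_type c_surj).
  apply: (hP _ _ Dy DN (loc_quotient_isomorphic N_prime gr_surj (@rees_gr_ker A I))).2.
  exact: (ha _ DG).1.
have DL : D (laurent A) := closed_finite_type hD DA (laurent_finite_type A).
have PL : P (laurent A).
  apply: (ha _ DL).2 => p p_prime.
  have q_prime := preim_ideal_prime (@rees_incl A I) p_prime.
  have Dq := closed_localization hD DS (prime_setC_mul q_prime).
  have Dp := closed_localization hD DL (prime_setC_mul p_prime).
  (* The localization at [p] is that of $S$ at the contraction of [p], which has the property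
     because $S$ does. *)
  have iso := loc_preim_isomorphic p_prime (@rees_incl_inj A I) (@rees_laurent_frac A I).
  by apply: (hP _ _ Dq Dp iso).1; exact: (ha _ DS).1.
exact: (hb _ _ _ DL (@laurent_const_inj A) (@laurent_faithfully_flat A) PL).
Qed.
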